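(* Let $G$ be a graph of order $n$ and size $m$ with maximum degree at most $3$ that is bipartite and $T^*$-free, and such that no connected component of $G$ is cubic. Then $$\gamma_e(G)\leq \frac{2n}{3}-\frac{m}{6}.$$ Furthermore, there is a polynomial time algorithm that, given such a graph $G$, finds a maximal matching of $G$ of size at most $\frac{2n}{3}-\frac{m}{6}$.
   Context: All graphs are finite, simple and undirected; order is the number of vertices and size the number of edges. A matching $M$ in $G$ is maximal if it is maximal with respect to inclusion among matchings. The edge domination number $\gamma_e(G)$ is the minimum size of a maximal matching in $G$. $T^*$ denotes the tree obtained from the claw $K_{1,3}$ by subdividing exactly two of its edges exactly once each; a graph is $T^*$-free if it has no induced subgraph isomorphic to $T^*$. A graph is cubic if every vertex has degree $3$. *)

(* Defs.v *)
From mathcomp Require Import all_boot.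

Set Implicit Arguments.
Unset Strict Implicit.
Unset Printing Implicit Defensive.

(** * Graphs *)

Record sgraph (V : finType) := SGraph {
  adj :> rel V;
  adj_sym : symmetric adj;
  adj_irr : irreflexive adj }.

Section Graphs.
Variable V : finType.
Implicit Types (G : sgraph V) (M : {set {set V}}).

Definition degree G (x : V) : nat := #|[set y | adj G x y]|.

Definition max_degree G : nat := \max_(x : V) degree G x.

Definition cubic G : Prop := forall x, degree G x = 3.

Definition edges G : {set {set V}} := [set [set x; y] | x in V, y in adj G x].

Definition bipartite G : Prop :=
  exists A : {set V}, forall x y, adj G x y -> (x \in A) != (y \in A).

Definition components G : {set {set V}} :=
  equivalence_partition (connect (adj G)) [set: V].

Section Induced.
Variables (G : sgraph V) (C : {set V}).
Definition induced_rel : rel {x : V | x \in C} := fun x y => adj G (val x) (val y).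
Fact induced_sym : symmetric induced_rel.
Proof. by move=> x y; apply: adj_sym. Qed.
Fact induced_irr : irreflexive induced_rel.
Proof. by move=> x; apply: adj_irr. Qed.
Definition induced : sgraph {x : V | x \in C} := SGraph induced_sym induced_irr.
End Induced.

Definition matching G : pred {set {set V}} :=
  fun M => (M \subset edges G) && trivIset M.

Definition maximal_matching G M : bool := maxset (matching G) M.

Lemma maximal_matching_size_exists G :
  exists k, [exists M, maximal_matching G M && (#|M| == k)].
Proof.
have [|M maxM] := @ex_maxset _ (matching G).
  exists set0; rewrite /matching sub0set; apply/trivIsetP=> A B.
  by rewrite inE.
by exists #|M|; apply/existsP; exists M; rewrite eqxx andbT.
Qed.

Definition edge_domination_number G : nat :=
  ex_minn (maximal_matching_size_exists G).

End Graphs.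

Definition isomorphic (V W : finType) (G : sgraph V) (H : sgraph W) : Prop :=
  exists2 f : V -> W, bijective f & forall x y, adj H (f x) (f y) = adj G x y.

Definition induced_free (W : finType) (H : sgraph W) (V : finType)
    (G : sgraph V) : Prop :=
  ~ exists C : {set V}, isomorphic (induced G C) H.

(** The claw has centre 0 and leaves 3, 4, 5; the edges 04 and 05 are
    subdivided by the vertices 1 and 2 respectively. *)
Definition Tstar_rel : rel 'I_6 := fun i j =>
  let E := [:: (0, 3); (0, 1); (1, 4); (0, 2); (2, 5)] in
  ((i : nat, j : nat) \in E) || ((j : nat, i : nat) \in E).
Fact Tstar_sym : symmetric Tstar_rel.
Proof. by move=> i j; rewrite /Tstar_rel orbC. Qed.
Fact Tstar_irr : irreflexive Tstar_rel.
Proof. by case=> [] [|[|[|[|[|[|]]]]]]. Qed.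
Definition Tstar : sgraph 'I_6 := SGraph Tstar_sym Tstar_irr.

Definition subcubic_class (V : finType) (G : sgraph V) : Prop :=
  [/\ max_degree G <= 3,
      bipartite G,
      induced_free Tstar G &
      forall C, C \in components G -> ~ cubic (induced G C)].

(** * Algorithms *)

(** Programs for a random access machine with registers and arrays of natural
    numbers, at unit cost per operation. Multiplication is deliberately not an
    operation: after [t] steps every stored number has O(t) more bits than the
    input and the program constants, so that unit-cost polynomial time is the
    usual (Turing machine) polynomial time. *)

Inductive expr :=
  | Num of nat
  | Reg of nat
  | Cell of nat & expr
  | Add of expr & expr
  | Sub of expr & expr
  | Eqn of expr & expr
  | Ltn of expr & expr.

Inductive prog :=
  | Skip
  | SetReg of nat & expr
  | SetCell of nat & expr & expr
  | Seq of prog & prog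
  | If of expr & prog & prog
  | While of expr & prog.

Record state := State { reg : nat -> nat; cell : nat -> nat -> nat }.

Fixpoint eval (s : state) (e : expr) : nat :=
  match e with
  | Num v => v
  | Reg x => reg s x
  | Cell a e1 => cell s a (eval s e1)
  | Add e1 e2 => eval s e1 + eval s e2
  | Sub e1 e2 => eval s e1 - eval s e2
  | Eqn e1 e2 => eval s e1 == eval s e2
  | Ltn e1 e2 => eval s e1 < eval s e2
  end.

Fixpoint cost (e : expr) : nat :=
  match e with
  | Num _ | Reg _ => 1
  | Cell _ e1 => (cost e1).+1
  | Add e1 e2 | Sub e1 e2 | Eqn e1 e2 | Ltn e1 e2 => (cost e1 + cost e2).+1
  end.

Definition set_reg (s : state) (x v : nat) : state :=
  State (fun y => if y == x then v else reg s y) (cell s).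

Definition set_cell (s : state) (a i v : nat) : state :=
  State (reg s)
        (fun b j => if (b == a) && (j == i) then v else cell s b j).

(** [exec p s t s']: started in [s], the program [p] halts in [s'] after [t]
    steps. *)
Inductive exec : prog -> state -> nat -> state -> Prop :=
  | ExecSkip s : exec Skip s 1 s
  | ExecSetReg s x e :
      exec (SetReg x e) s (cost e).+1 (set_reg s x (eval s e))
  | ExecSetCell s a i e :
      exec (SetCell a i e) s (cost i + cost e).+1
           (set_cell s a (eval s i) (eval s e))
  | ExecSeq p q s1 s2 s3 t1 t2 :
      exec p s1 t1 s2 -> exec q s2 t2 s3 -> exec (Seq p q) s1 (t1 + t2) s3
  | ExecIfTrue e p q s s' t :
      eval s e != 0 -> exec p s t s' -> exec (If e p q) s ((cost e).+1 + t) s'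
  | ExecIfFalse e p q s s' t :
      eval s e = 0 -> exec q s t s' -> exec (If e p q) s ((cost e).+1 + t) s'
  | ExecWhileFalse e p s :
      eval s e = 0 -> exec (While e p) s (cost e).+1 s
  | ExecWhileTrue e p s1 s2 s3 t1 t2 :
      eval s1 e != 0 -> exec p s1 t1 s2 -> exec (While e p) s2 t2 s3 ->
      exec (While e p) s1 ((cost e).+1 + t1 + t2) s3.

(** The row-major 0/1 adjacency matrix of an edge set on ['I_n], zero beyond
    its [n * n] entries. *)
Definition adjacency_array (n : nat) (F : {set {set 'I_n}}) (k : nat) : nat :=
  [exists x : 'I_n, exists y : 'I_n,
     (k == x * n + y) && ([set x; y] \in F)].

(** A graph is input as its order in register 0 and its adjacency matrix in
    array 0, everything else being zero; an edge set is output as its adjacency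
    matrix in array 1. *)
Definition input (n : nat) (G : sgraph 'I_n) : state :=
  State (fun x => if x == 0 then n else 0)
        (fun a => if a == 0 then adjacency_array (edges G) else fun=> 0).

Definition outputs (n : nat) (s : state) (M : {set {set 'I_n}}) : Prop :=
  forall k, k < n * n -> cell s 1 k = adjacency_array M k.

(** The input consists of [n * n + 1] numbers, so polynomial in [n] and
    polynomial in the size of the input mean the same. *)
Definition poly_time_solvable
    (instance : forall n, sgraph 'I_n -> Prop)
    (solution : forall n, sgraph 'I_n -> {set {set 'I_n}} -> Prop) : Prop :=
  exists (p : prog) (c d : nat), forall n (G : sgraph 'I_n), instance n G ->
    exists (t : nat) (s : state) (M : {set {set 'I_n}}),
      [/\ exec p (input G) t s, t <= c * n.+1 ^ d, outputs s M
        & solution n G M].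

(* Main.v *)
Require Import Defs.
From mathcomp Require Import all_boot all_order all_algebra zify lra.

Set Implicit Arguments.
Unset Strict Implicit.
Unset Printing Implicit Defensive.

(** Call a set of at most six disjoint edges a reduction if deleting its [2j]
    end vertices, which isolates [k] further vertices, destroys at most
    [2j + 4k] edges. Each reduction lowers the potential 4 * #(non-isolated
    vertices) - #edges by at least [6j], so reductions applied until no edge is
    left yield a maximal matching within the bound.

    A reduction exists as soon as some vertex has degree 1 or 2: exploring the
    graph from this vertex, one meets an induced T* or one of 22 fixed
    reductions before more than 15 vertices are discovered. Such a vertex exists
    while an edge is left, because in a subcubic graph a cubic induced subgraph
    is a union of components; hence no vertex subset induces a cubic graph, a
    property that survives the deletion of vertices.

    The algorithm tries all sequences of at most six disjoint edges in order to
    find the next reduction. *)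

(** * Deleting vertices *)

Section Deletion.
Variable V : finType.
Implicit Types (e : rel V) (D X I : {set V}).

Definition del D e : rel V := fun x y => [&& e x y, x \notin D & y \notin D].
Definition nbhd e x : {set V} := [set y | e x y].
Definition nonisolated e : {set V} := [set x | [exists y, e x y]].
Definition num_arcs e : nat := \sum_x \sum_y e x y.

(* Twice the reduction inequality, since [num_arcs] counts every edge twice. *)
Definition profitable e (j : nat) D : bool :=
  12 * j + 8 * #|nonisolated (del D e)| + num_arcs e
    <= 8 * #|nonisolated e| + num_arcs (del D e).

Lemma card_setI_nbhd e x X : #|nbhd e x :&: X| = \sum_y (e x y && (y \in X)).
Proof.
rewrite -sum1_card big_mkcond; apply: eq_bigr => y _.
by rewrite !inE; case: (_ && _).
Qed.

Lemma card_nbhd e x : #|nbhd e x| = \sum_y e x y.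
Proof.
by rewrite -(setIT (nbhd e x)) card_setI_nbhd; apply: eq_bigr => y _; rewrite inE andbT.
Qed.

(** By symmetry as many arcs enter [X] as leave its vertices, namely the degree sum over [X];
    deleting [X] removes both kinds, and arcs inside [X] are counted twice. *)
Lemma num_arcs_del e X : symmetric e ->
  num_arcs e + \sum_(x in X) #|nbhd e x :&: X|
    = num_arcs (del X e) + \sum_(x in X) 2 * #|nbhd e x|.
Proof.
move=> e_sym; rewrite -big_distrr /= mul2n -addnn.
have cross : \sum_(x in X) #|nbhd e x| = \sum_x \sum_y (e x y && (y \in X)).
  rewrite exchange_big /= big_mkcond; apply: eq_bigr => x _.
  rewrite card_nbhd; case: (x \in X); last by rewrite big1 // => y _; rewrite andbF.
  by apply: eq_bigr => y _; rewrite andbT e_sym.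
rewrite {2}cross !(big_mkcond (fun x => x \in X)) /num_arcs -!big_split.
apply: eq_bigr => x _ /=; rewrite card_nbhd card_setI_nbhd.
case xX: (x \in X); rewrite ?addn0 ?add0n -!big_split.
  by apply: eq_bigr => y _; rewrite /= /del xX; case: (e x y); case: (y \in X).
by apply: eq_bigr => y _; rewrite /= /del xX; case: (e x y); case: (y \in X).
Qed.

Lemma del_set0 e : del set0 e =2 e.
Proof. by move=> x y; rewrite /del !inE andbT. Qed.

Lemma delU D X e : del X (del D e) =2 del (D :|: X) e.
Proof.
move=> x y; rewrite /del !inE !negb_or.
by case: (e x y) => //=; case: (x \in D); case: (y \in D); rewrite ?andbF.
Qed.

Lemma eq_nonisolated e e' : e =2 e' -> nonisolated e = nonisolated e'.
Proof. by move=> ee; apply/setP=> x; rewrite !inE; apply: eq_existsb. Qed.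

Lemma eq_num_arcs e e' : e =2 e' -> num_arcs e = num_arcs e'.
Proof. by move=> ee; apply: eq_bigr => x _; apply: eq_bigr => y _; rewrite ee. Qed.

(** The vertices of [X] are deleted and those of [I] lose all their neighbours, so both disjoint
    sets leave the non-isolated vertices. *)
Lemma card_nonisolated_del e X I :
  X \subset nonisolated e -> I \subset nonisolated e -> [disjoint I & X] ->
  (forall v, v \in I -> nbhd e v \subset X) ->
  #|nonisolated (del X e)| + (#|X| + #|I|) <= #|nonisolated e|.
Proof.
move=> XsubN IsubN disIX nbhdI.
have disXI : #|X :|: I| = #|X| + #|I|.
  by rewrite cardsU disjoint_setI0 1?disjoint_sym // cards0 subn0.
rewrite -disXI -[leqLHS]subn0 -(_ : #|nonisolated (del X e) :&: (X :|: I)| = 0).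
  rewrite -cardsU; apply: subset_leq_card; rewrite !subUset XsubN IsubN !andbT.
  by apply/subsetP => x; rewrite !inE => /existsP[y /and3P[exy _ _]]; apply/existsP; exists y.
apply/eqP; rewrite cards_eq0; apply/eqP/setP => x; rewrite !inE.
apply/negbTE/negP => /andP[/existsP[y /and3P[exy xX yX]]]; rewrite (negbTE xX) /=.
by move=> /nbhdI/subsetP/(_ y); rewrite inE exy (negbTE yX) => /(_ isT).
Qed.
End Deletion.

(** * Exploration of partially known graphs *)

(* The vertices of a partially known graph are the positions of a sequence. A
   node is [full] if all its neighbours are known; [side] is its colour. *)
Record node := Node { nbrs : seq nat; full : bool; side : bool }.
Definition config := seq node.
Definition blank := Node [::] false false.
Definition get (st : config) i := nth blank st i.

(** By the degree bound, three known neighbours are all neighbours. *)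
Definition closed_at (st : config) i :=
  full (get st i) || (2 < size (nbrs (get st i))).

Definition add_nbr (st : config) i j :=
  let u := get st i in
  set_nth blank st i
    (Node (if j \in nbrs u then nbrs u else rcons (nbrs u) j) (full u) (side u)).

Definition add_edge (st : config) i j := add_nbr (add_nbr st i j) j i.

Definition set_full (st : config) i :=
  let u := get st i in set_nth blank st i (Node (nbrs u) true (side u)).

Definition add_node (st : config) b : config := rcons st (Node [::] false b).

(* [vm_compute] is call-by-value and would evaluate both sides of [||]. *)
Fixpoint lazy_has (T : Type) (p : T -> bool) s :=
  if s is x :: s' then if p x then true else lazy_has p s' else false.

(** Certain for two vertices of one colour, and for an unlisted pair with an end whose neighbours
    are all known. Both lists are tested because [embeds] does not make them symmetric. *)
Definition non_adjacent (st : config) i j :=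
  if side (get st i) == side (get st j) then true else
  if j \in nbrs (get st i) then false else
  if i \in nbrs (get st j) then false else
  if closed_at st i then true else closed_at st j.

Definition Tstar_edge (i j : nat) :=
  let E := [:: (0, 3); (0, 1); (1, 4); (0, 2); (2, 5)] in
  ((i, j) \in E) || ((j, i) \in E).

Definition is_Tstar (st : config) (s : seq nat) :=
  [&& size s == 6, uniq s, all (gtn (size st)) s
    & all (fun i => all (fun j =>
        if Tstar_edge i j then nth 0 s j \in nbrs (get st (nth 0 s i))
        else non_adjacent st (nth 0 s i) (nth 0 s j)) (iota 0 6)) (iota 0 6)].

(** [c] is the centre, [a] and [b] the subdividing vertices, [d] the leaf at the centre, [p] and [q]
    the far ends; [a < b] avoids mirror images. The tests before [is_Tstar] are a cheap filter. *)
Definition has_Tstar (st : config) :=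
  let N i := nbrs (get st i) in
  lazy_has (fun c => if size (N c) != 3 then false else
    lazy_has (fun a => lazy_has (fun b => lazy_has (fun d =>
      if (b <= a) || (a == d) || (b == d) then false else
      lazy_has (fun p => lazy_has (fun q =>
        if p == c then false else if q == c then false else
        if non_adjacent st d p then
          if non_adjacent st d q then is_Tstar st [:: c; a; b; d; p; q] else false
        else false) (N b)) (N a)) (N c)) (N c)) (N c)) (iota 0 (size st)).

Definition endpoints (T : Type) (W : seq (T * T)) : seq T :=
  flatten [seq [:: p.1; p.2] | p <- W].

(** The inequality [profitable] with safe estimates: an open vertex counts with degree 3, only known
    edges inside [X] are credited, and [I] collects vertices sure to become isolated. *)
Definition is_reduction (st : config) (W : seq (nat * nat)) :=
  let N i := nbrs (get st i) in
  let X := endpoints W in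
  let I := [seq i <- iota 0 (size st) |
     [&& closed_at st i, i \notin X, N i != [::] & all (mem X) (N i)]] in
  let deg i := if closed_at st i then size (N i) else 3 in
  [&& W != [::], size W <= 6, uniq X,
      all (gtn (size st)) X, all (fun p => p.2 \in N p.1) W
    & 12 * size W + sumn [seq 2 * deg i | i <- X]
        <= 8 * (size X + size I) + sumn [seq count (mem X) (N i) | i <- X]].

(* The vertices are numbered in the order of their discovery. The list was found
   by a computer search and covers all leaves of the two runs of [solve] below
   that do not contain an induced T*. *)
Definition reduction_table : seq (seq (nat * nat)) :=
  [:: [:: (0, 1)];
    [:: (1, 2)];
    [:: (0, 1); (4, 7)];
    [:: (0, 2); (1, 3)];
    [:: (0, 2); (3, 4)];
    [:: (0, 2); (3, 6)];
    [:: (0, 2); (6, 9)];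
    [:: (1, 3); (2, 4)];
    [:: (1, 3); (2, 5)];
    [:: (1, 4); (2, 3)];
    [:: (1, 4); (3, 8)];
    [:: (0, 1); (3, 6); (5, 7)];
    [:: (0, 1); (4, 6); (5, 7)];
    [:: (0, 1); (4, 7); (5, 6)];
    [:: (1, 3); (2, 5); (4, 7)];
    [:: (1, 4); (2, 5); (3, 6)];
    [:: (1, 4); (2, 5); (3, 7)];
    [:: (0, 1); (4, 7); (5, 9); (6, 10)];
    [:: (0, 2); (3, 7); (5, 9); (8, 12)];
    [:: (1, 4); (2, 6); (5, 10); (12, 13)];
    [:: (0, 1); (4, 8); (5, 9); (6, 10); (7, 11)];
    [:: (1, 4); (2, 6); (3, 8); (5, 10); (11, 13); (12, 14)]].

(* Checks that every graph containing the given configuration has an induced T* or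
   a reduction in the table, branching over the neighbours of the first vertex
   that may still have unknown ones. *)
Fixpoint solve (table : seq (seq (nat * nat))) fuel (st : config) :=
  if fuel is k.+1 then
    if lazy_has (is_reduction st) table then true else
    if has_Tstar st then true else
    if [seq i <- iota 0 (size st) | ~~ closed_at st i] is v :: _ then
      let candidate w :=
        [&& side (get st w) != side (get st v), w \notin nbrs (get st v)
          & ~~ closed_at st w || (v \in nbrs (get st w))] in
      [&& solve table k (set_full st v),
          solve table k (add_edge (add_node st (~~ side (get st v))) v (size st))
        & all (fun w => if candidate w then solve table k (add_edge st v w) else true)
            (iota 0 (size st))]
    else false
  else false.

Definition isolated_node : config := [:: Node [::] false false].
Definition start1 := add_edge (add_node isolated_node true) 0 1.
Definition start2 := add_edge (add_node start1 true) 0 2.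

(** The first vertex has degree 1 here and degree 2 in the run from [start2]. The fuel 20 bounds the
    depth of branching; exhausting it would give [false]. *)
Lemma solve_start1 : solve reduction_table 20 (set_full start1 0).
Proof. by vm_compute. Qed.
Lemma solve_start2 : solve reduction_table 20 (set_full start2 0).
Proof. by vm_compute. Qed.

(** * Soundness of the exploration *)

Section Soundness.
Variables (V : finType) (e : rel V) (A : {set V}).
Hypothesis e_sym : symmetric e.
Hypothesis e_bip : forall x y, e x y -> (x \in A) != (y \in A).
Hypothesis e_deg : forall x, #|nbhd e x| <= 3.
Hypothesis e_Tstar_free :
  forall g : 'I_6 -> V, injective g -> ~ (forall i j, e (g i) (g j) = Tstar_rel i j).

(* [b] tells whether the two sides of the configuration are swapped. *)
Record embeds (st : config) (f : nat -> V) (b : bool) : Prop := Embeds {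
  emb_inj : forall i j, i < size st -> j < size st -> f i = f j -> i = j;
  emb_side : forall i, i < size st -> (f i \in A) = b (+) side (get st i);
  emb_uniq : forall i, uniq (nbrs (get st i));
  emb_adj : forall i j, i < size st -> j \in nbrs (get st i) ->
    j < size st /\ e (f i) (f j);
  emb_full : forall i y, i < size st -> full (get st i) -> e (f i) y ->
    y \in map f (nbrs (get st i)) }.

Definition reducible := exists W : seq (V * V),
  [/\ W != [::], size W <= 6, uniq (endpoints W), all (fun p => e p.1 p.2) W
    & profitable e (size W) [set x in endpoints W]].

Section State.
Variables (st : config) (f : nat -> V) (b : bool).
Hypothesis emb : embeds st f b.

Lemma uniq_map_nbrs i : i < size st -> uniq (map f (nbrs (get st i))).
Proof.
move=> ist; rewrite map_inj_in_uniq ?(emb_uniq emb) // => j k jN kN.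
have [jst _] := emb_adj emb ist jN; have [kst _] := emb_adj emb ist kN.
exact: (emb_inj emb).
Qed.

Lemma sub_map_nbrs i : i < size st -> {subset map f (nbrs (get st i)) <= nbhd e (f i)}.
Proof. by move=> ist y /mapP[j jN ->]; rewrite inE; have [] := emb_adj emb ist jN. Qed.

(** Three distinct known neighbours fill the neighbourhood, which has at most three elements. *)
Lemma closed_atP i y : closed_at st i -> i < size st -> e (f i) y ->
  y \in map f (nbrs (get st i)).
Proof.
move=> /orP[fi | big] ist eiy; first exact: (emb_full emb).
have [] // := uniq_min_size (s2 := enum (nbhd e (f i))) (uniq_map_nbrs ist).
- by move=> z /(sub_map_nbrs ist); rewrite mem_enum.
- by rewrite -cardE size_map (leq_trans (e_deg _)).
by move=> _ ->; rewrite mem_enum inE.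
Qed.

Lemma card_nbhd_le i : i < size st ->
  #|nbhd e (f i)| <= if closed_at st i then size (nbrs (get st i)) else 3.
Proof.
move=> ist; case: ifP => [ci | _]; last exact: e_deg.
rewrite cardE -(size_map f); apply: uniq_leq_size (enum_uniq _) _ => y.
by rewrite mem_enum inE; exact: closed_atP.
Qed.

Lemma non_adjacentP i j : non_adjacent st i j -> i < size st -> j < size st ->
  e (f i) (f j) = false.
Proof.
move=> + ist jst; apply: contraTF => eij; rewrite /non_adjacent.
have closedF k l : k < size st -> l < size st -> e (f k) (f l) -> closed_at st k ->
    l \in nbrs (get st k).
  move=> kst lst ekl ck; have /mapP[l' l'N /(emb_inj emb) -> //] := closed_atP ck kst ekl.
  by have [] := emb_adj emb kst l'N.
case: eqP => [eqs | _].
  by have := e_bip eij; rewrite !(emb_side emb) // eqs eqxx.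
case: ifP => // /negbT jN; case: ifP => // /negbT iN.
case: ifP => [ci | _]; first by rewrite (closedF i j) in jN.
by apply: contra iN; apply: closedF => //; rewrite e_sym.
Qed.

Lemma is_TstarF s : is_Tstar st s -> False.
Proof.
case/and4P=> /eqP sz_s uniq_s /allP s_lt /allP Ts.
have nth_lt (i : 'I_6) : nth 0 s i < size st by apply/s_lt/mem_nth; rewrite sz_s.
apply: (e_Tstar_free (g := fun i => f (nth 0 s i))) => [i j | i j].
  move=> /(emb_inj emb (nth_lt i) (nth_lt j))/eqP.
  by rewrite nth_uniq ?sz_s // => /eqP/val_inj.
have /allP/(_ (val j)) := Ts (val i) ltac:(by rewrite mem_iota /=).
rewrite mem_iota /= => /(_ (ltn_ord j)); rewrite -[Tstar_rel i j]/(Tstar_edge i j).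
case: ifP => _; first by case/(emb_adj emb).
by move/non_adjacentP; apply.
Qed.

Lemma lazy_hasP (T : eqType) (p : pred T) s : lazy_has p s -> exists2 x, x \in s & p x.
Proof.
elim: s => //= x s IHs; case: ifP => [px _ | _ /IHs[y ys py]].
  by exists x; rewrite ?mem_head.
by exists y; rewrite // inE ys orbT.
Qed.

Lemma has_TstarF : has_Tstar st -> False.
Proof.
case/lazy_hasP=> c _; case: ifP => // _ /lazy_hasP[a _ /lazy_hasP[b' _ /lazy_hasP[d _]]].
case: ifP => // _ /lazy_hasP[p _ /lazy_hasP[q _]].
by do 4![case: ifP => // _]; exact: is_TstarF.
Qed.

Lemma map_endpoints (W : seq (nat * nat)) :
  endpoints [seq (f p.1, f p.2) | p <- W] = map f (endpoints W).
Proof. by rewrite /endpoints; elim: W => //= p W ->. Qed.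

(** [num_arcs_del] gives the exact loss of arcs and [card_nonisolated_del] bounds the remaining
    non-isolated vertices; the estimates read off the configuration err on the safe side. *)
Lemma is_reductionP W : is_reduction st W -> reducible.
Proof.
case/and4P=> W0 szW uniqX /and3P[/allP X_lt /allP W_adj].
(* [deg2] is twice the degree estimate, and [value] the numerical test of [is_reduction]. *)
set X := endpoints W; set I := [seq i <- _ | _]; set deg2 := fun i : nat => _ => value.
have uniq_map s : uniq s -> {in s, forall i, i < size st} -> uniq (map f s).
  by move=> us s_lt; rewrite map_inj_in_uniq // => i j /s_lt ? /s_lt ?; apply: (emb_inj emb).
have uniqfX := uniq_map _ uniqX X_lt.
have I_lt : {in I, forall i, i < size st} by move=> i; rewrite mem_filter mem_iota => /andP[].
have uniqI : uniq I by rewrite filter_uniq ?iota_uniq.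
have mem_fX i : i < size st -> (f i \in map f X) = (i \in X).
  move=> ist; apply/mapP/idP => [[j jX /(emb_inj emb) ->] | iX]; last by exists i.
  - by [].
  - by [].
  - exact: X_lt.
exists [seq (f p.1, f p.2) | p <- W]; split.
- by case: W W0 {X I uniqfX uniqX X_lt W_adj szW value uniqI I_lt mem_fX deg2}.
- by rewrite size_map.
- by rewrite map_endpoints.
- apply/allP => _ /mapP[p pW ->] /=; have [] // := emb_adj emb _ (W_adj p pW).
  apply: X_lt; apply/flattenP; exists [:: p.1; p.2]; rewrite ?mem_head //.
  by apply/mapP; exists p.
rewrite map_endpoints size_map /profitable; set Y := [set x in _].
have sumY (F : V -> nat) : \sum_(x in Y) F x = \sum_(i <- X) F (f i).
  rewrite -(big_map f xpredT) big_uniq //=; apply: eq_bigl => x.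
  by rewrite inE.
have arcs_eq := num_arcs_del Y e_sym; rewrite !sumY in arcs_eq.
have le_deg : \sum_(i <- X) 2 * #|nbhd e (f i)| <= sumn [seq deg2 i | i <- X].
  rewrite sumnE big_map big_seq [leqRHS]big_seq; apply: leq_sum => i iX.
  by rewrite /deg2 leq_mul2l; apply: (@card_nbhd_le i); apply: X_lt.
have le_inner : sumn [seq count (mem X) (nbrs (get st i)) | i <- X]
    <= \sum_(i <- X) #|nbhd e (f i) :&: Y|.
  rewrite sumnE big_map big_seq [leqRHS]big_seq; apply: leq_sum => i /X_lt ist.
  rewrite -size_filter -(size_map f) cardE; apply: uniq_leq_size => [|y].
    rewrite map_inj_in_uniq ?filter_uniq ?(emb_uniq emb) // => k l.
    rewrite !mem_filter => /andP[kX _] /andP[lX _].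
    by apply: (emb_inj emb); apply: X_lt.
  case/mapP=> k; rewrite mem_filter => /andP[kX kN] ->.
  rewrite mem_enum !inE (map_f f (kX : k \in X)) andbT; by have [] := emb_adj emb ist kN.
have cardY : #|Y| = size X by rewrite cardsE (card_uniqP uniqfX) size_map.
pose J := [set x in map f I].
have cardJ : #|J| = size I by rewrite cardsE (card_uniqP (uniq_map _ uniqI I_lt)) size_map.
have YN : Y \subset nonisolated e.
  apply/subsetP => x; rewrite inE => /mapP[i iX ->{x}].
  have /flattenP[_ /mapP[p pW ->]] := iX.
  have p1st : p.1 < size st.
    by apply: X_lt; apply/flattenP; exists [:: p.1; p.2]; rewrite ?mem_head ?map_f.
  have [_ adj12] := emb_adj emb p1st (W_adj p pW).
  rewrite !inE => /orP[] /eqP ->; apply/existsP; [by exists (f p.2)|exists (f p.1)].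
  by rewrite e_sym.
have JN : J \subset nonisolated e.
  apply/subsetP => x; rewrite inE => /mapP[i iI ->{x}].
  have ist := I_lt i iI.
  move: iI; rewrite mem_filter => /andP[/and4P[_ _ N0 _] _].
  case defN: (nbrs (get st i)) N0 => [//|k N] _; rewrite inE; apply/existsP; exists (f k).
  by have [] := emb_adj emb ist (j := k); rewrite ?defN ?mem_head.
have disJY : [disjoint J & Y].
  rewrite disjoint_subset; apply/subsetP => x; rewrite !inE => /mapP[i iI ->{x}].
  by rewrite mem_fX ?I_lt //; move: iI; rewrite mem_filter => /andP[/and4P[]].
have nbhdJ v : v \in J -> nbhd e v \subset Y.
  rewrite inE => /mapP[i iI ->]; apply/subsetP => y; rewrite !inE => eiy.
  move: (iI); rewrite mem_filter => /andP[/and4P[ci _ _ /allP NX] _].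
  have /mapP[k kN ->] := closed_atP ci (I_lt i iI) eiy.
  by rewrite map_f //; apply: NX.
have := card_nonisolated_del YN JN disJY nbhdJ.
rewrite cardY cardJ; move: value arcs_eq le_deg le_inner.
have arith (w a a' n n' d c s t k : nat) : 12 * w + d <= 8 * k + c ->
    a + t = a' + s -> s <= d -> c <= t -> n' + k <= n -> 12 * w + 8 * n' + a <= 8 * n + a'.
  by lia.
exact: arith.
Qed.
End State.

(** * Extending an embedded configuration *)

Lemma size_set st i u : i < size st -> size (set_nth blank st i u) = size st.
Proof. by move=> ist; rewrite size_set_nth; apply/maxn_idPr. Qed.

Lemma get_set st i u k : get (set_nth blank st i u) k = if k == i then u else get st k.
Proof. by rewrite /get nth_set_nth. Qed.

Lemma embeds_add_nbr st f b i j : embeds st f b -> i < size st -> j < size st ->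
  e (f i) (f j) -> embeds (add_nbr st i j) f b.
Proof.
case=> inj sid uni adj ful ist jst eij; rewrite /add_nbr.
split=> [k l | k | k | k l | k y]; rewrite ?size_set // ?get_set.
- exact: inj.
- by move=> kst; case: eqP => [-> | _]; apply: sid.
- case: eqP => // _ /=; case: ifP => // jN.
  by rewrite rcons_uniq jN uni.
- move=> kst; case: eqP => [-> | _] /=; last exact: adj.
  case: ifP => _; first exact: adj.
  by rewrite mem_rcons inE => /orP[/eqP -> | /adj]; [|apply].
- move=> kst; case: eqP => [-> /= fi eiy| _]; last exact: ful.
  have yN := ful _ _ ist fi eiy; case: ifP => // _.
  by rewrite map_rcons mem_rcons inE yN orbT.
Qed.

Lemma embeds_add_edge st f b i j : embeds st f b -> i < size st -> j < size st ->
  e (f i) (f j) -> embeds (add_edge st i j) f b.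
Proof.
move=> emb ist jst eij; apply: embeds_add_nbr; rewrite ?size_set // 1?e_sym //.
exact: embeds_add_nbr.
Qed.

Lemma embeds_set_full st f b i : embeds st f b -> i < size st ->
  (forall y, e (f i) y -> y \in map f (nbrs (get st i))) -> embeds (set_full st i) f b.
Proof.
case=> inj sid uni adj ful ist iN; rewrite /set_full.
split=> [k l | k | k | k l | k y]; rewrite ?size_set // ?get_set.
- exact: inj.
- by move=> kst; case: eqP => [-> | _]; apply: sid.
- by case: eqP => // _; apply: uni.
- by move=> kst; case: eqP => [-> | _]; apply: adj.
- by move=> kst; case: eqP => [-> _| _]; [exact: iN | exact: ful].
Qed.

Definition extend (st : config) (f : nat -> V) y := fun k => if k == size st then y else f k.

Lemma embeds_add_node st f b y : embeds st f b ->
  (forall i, i < size st -> f i <> y) -> embeds (add_node st (b (+) (y \in A))) (extend st f y) b.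
Proof.
case=> inj sid uni adj ful fresh.
have get_node c k : get (add_node st c) k =
    if k == size st then Node [::] false c else get st k.
  by rewrite /get nth_rcons; case: ltngtP => // lt_st; rewrite nth_default // ltnW.
rewrite /add_node /extend.
(* Known neighbours have numbers below [size st], so the new value of [f] does not affect them. *)
have map_ext k : map (fun k => if k == size st then y else f k) (nbrs (get st k))
    = map f (nbrs (get st k)) \/ size st <= k.
  case: (ltnP k (size st)) => kst; [left | by right].
  by apply/eq_in_map => l /(adj _ _ kst)[lst _]; rewrite ltn_eqF.
split=> [k l | k | k | k l | k z]; rewrite ?size_rcons ?ltnS ?get_node.
- rewrite [k <= _]leq_eqVlt [l <= _]leq_eqVlt; case: eqP => [-> | _]; case: eqP => [-> // | _] /=.
  + by move=> _ lst /esym/(fresh _ lst).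
  + by move=> kst _ /(fresh _ kst).
  + exact: inj.
- rewrite leq_eqVlt; case: eqP => [_ _ | _ /sid] //=.
  by rewrite addbA addbb.
- by case: eqP.
- rewrite leq_eqVlt; case: eqP => //= _ kst /(adj _ _ kst)[lst ekl].
  by rewrite ltnW // ltn_eqF.
- rewrite leq_eqVlt; case: eqP => //= _ kst fk ekz.
  by have [-> | ] := map_ext k; [exact: ful | rewrite leqNgt kst].
Qed.

Lemma embeds_new_nbr st f b v y : embeds st f b -> v < size st -> e (f v) y ->
  (forall i, i < size st -> f i <> y) ->
  embeds (add_edge (add_node st (~~ side (get st v))) v (size st)) (extend st f y) b.
Proof.
move=> emb vst evy fresh.
have -> : ~~ side (get st v) = b (+) (y \in A).
  have := e_bip evy; rewrite (emb_side emb vst).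
  by case: (b) (side _) (y \in A) => [] [] [].
apply: embeds_add_edge; rewrite ?size_rcons ?ltnS ?leqnn //; first exact: embeds_add_node.
  exact: ltnW.
by rewrite /extend eqxx ltn_eqF.
Qed.

(** Follow the branch that is true in the graph: either all neighbours of [v] are known, or some
    unlisted neighbour is a new vertex or one discovered earlier. *)
Lemma solve_sound table k st f b : embeds st f b -> solve table k st -> reducible.
Proof.
elim: k st f => //= k IHk st f emb.
case: ifP => [/lazy_hasP[W _ /(is_reductionP emb)] | _] //.
case: ifP => [/(has_TstarF emb) // | _].
case defv: [seq _ <- _ | _] => [//|v s].
have : v \in [seq i <- iota 0 (size st) | ~~ closed_at st i] by rewrite defv mem_head.
rewrite mem_filter mem_iota => /= /andP[_ vst] /and3P[solve_full solve_new /allP solve_old].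
have [/existsP[y /andP[evy yN]] | /existsPn full_v] :=
    boolP [exists y, e (f v) y && (y \notin map f (nbrs (get st v)))]; last first.
  apply: (IHk _ f) solve_full; apply: embeds_set_full => // y evy.
  by have := full_v y; rewrite evy negbK.
have [/hasP[w] | /hasPn fresh] := boolP (has (fun w => f w == y) (iota 0 (size st))); last first.
  apply: (IHk _ _ (embeds_new_nbr emb vst evy _) solve_new) => i ist; apply/eqP.
  by apply: fresh; rewrite mem_iota.
rewrite mem_iota /= => wst /eqP def_y; have := solve_old w; rewrite mem_iota wst => /(_ isT).
rewrite -def_y in evy yN.
rewrite ifT; first by apply: IHk; apply: embeds_add_edge emb vst wst evy.
apply/and3P; split.
- by apply: contraNN (e_bip evy) => /eqP eq_side; rewrite !(emb_side emb) // eq_side.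
- by apply: contra yN => wN; apply: map_f.
(* A closed [w] already lists all its neighbours, [v] among them. *)
- case cw: (closed_at st w) => //=.
  have ewv : e (f w) (f v) by rewrite e_sym.
  have /mapP[v' v'N /(emb_inj emb) -> //] := closed_atP emb cw wst ewv.
  by have [] := emb_adj emb wst v'N.
Qed.

(** The exploration starts at [x], whose node has side [false]; the swap bit is therefore [x \in A].
    The two runs treat degrees 1 and 2. *)
Lemma reducible_of_small_degree x : 0 < #|nbhd e x| < 3 -> reducible.
Proof.
case/andP; rewrite card_gt0 => /set0Pn[y]; rewrite inE => exy deg_x.
have emb0 : embeds isolated_node (fun=> x) (x \in A).
  split=> [i j | i | i | i j | i y'] /=; rewrite ?ltnS ?leqn0.
  - by move=> /eqP -> /eqP ->.
  - by move=> /eqP -> /=; rewrite addbF.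
  - by case: i => [|[]].
  - by move=> /eqP ->.
  - by move=> /eqP ->.
have neq u : e x u -> x <> u by move=> /e_bip xu defx; rewrite defx eqxx in xu.
have emb1 : embeds start1 (extend isolated_node (fun=> x) y) (x \in A).
  by apply: (embeds_new_nbr emb0 (v := 0)) => // i _; apply: neq.
have [/subsetP sub_y | /subsetPn[z]] := boolP (nbhd e x \subset [set y]).
  apply: solve_sound (embeds_set_full emb1 _ _) solve_start1 => // u exu.
  by have := sub_y u; rewrite !inE => ->.
rewrite !inE => exz zy.
have emb2 : embeds start2 (extend start1 (extend isolated_node (fun=> x) y) z) (x \in A).
  apply: (embeds_new_nbr emb1 (v := 0)) => // -[|[|//]] _ /=; first exact: neq.
  by apply/eqP; rewrite eq_sym.
apply: solve_sound (embeds_set_full emb2 _ _) solve_start2 => // u exu.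
rewrite !inE; apply: contraTT deg_x; rewrite negb_or -leqNgt => /andP[uy uz].
have <- : #|u |: [set y; z]| = 3.
  by rewrite cardsU1 cards2 !inE negb_or uy uz eq_sym zy.
by apply: subset_leq_card; apply/subsetP => t; rewrite !inE => /or3P[] /eqP ->.
Qed.
End Soundness.

(** * Greedy matchings *)

Section Class.
Variables (V : finType) (G : sgraph V).
Implicit Types (D X : {set V}) (M : {set {set V}}).

Lemma edgesP (F : {set V}) :
  reflect (exists x y, adj G x y /\ F = [set x; y]) (F \in edges G).
Proof.
apply: (iffP imset2P) => [[x y _ xy ->] | [x [y [xy ->]]]]; first by exists x, y.
by exists x y; rewrite ?inE.
Qed.

Lemma mem_edges x y : ([set x; y] \in edges G) = adj G x y.
Proof.
apply/edgesP/idP => [[u [v [uv eqs]]] | xy]; last by exists x, y.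
have xy_uv : (x \in [set u; v]) && (y \in [set u; v]) by rewrite -eqs !inE !eqxx orbT.
have uv_xy : (u \in [set x; y]) && (v \in [set x; y]) by rewrite eqs !inE !eqxx orbT.
have neq_uv : u != v by apply: contraTneq uv => ->; rewrite adj_irr.
move: xy_uv uv_xy neq_uv; rewrite !inE.
case/andP=> /orP[] /eqP -> /orP[] /eqP ->; [|by []|by rewrite adj_sym|].
  by rewrite !orbb => /andP[_ /eqP ->]; rewrite eqxx.
by rewrite !orbb => /andP[/eqP -> _]; rewrite eqxx.
Qed.

Hypothesis G_class : subcubic_class G.

Lemma card_nbhd_le3 x : #|nbhd G x| <= 3.
Proof. by case: G_class => D3 _ _ _; apply: leq_trans D3; apply: (leq_bigmax x). Qed.

(** The image of [g] induces a subgraph that the inverse of [g] maps isomorphically onto [Tstar]. *)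
Lemma Tstar_free_map (g : 'I_6 -> V) : injective g ->
  ~ (forall i j, adj G (g i) (g j) = Tstar_rel i j).
Proof.
move=> g_inj gT; case: G_class => _ _ noT _; apply: noT.
pose C := g @: [set: 'I_6]; exists C.
have gC i : g i \in C by rewrite imset_f.
pose h i : {x | x \in C} := Sub (g i) (gC i).
have h_inj : injective h by move=> i j /(congr1 val) /g_inj.
have card_C : #|{: {x | x \in C}}| = #|'I_6|.
  by rewrite card_sig (card_imset _ g_inj) cardsT.
have [k hK kK] : bijective h by apply: inj_card_bij; rewrite ?card_C.
exists k; first by exists h.
by move=> x y; rewrite -[x in RHS]kK -[y in RHS]kK /= /induced_rel /= gT.
Qed.

(** Otherwise each vertex of [C] has its three neighbours in [C], so [C] is closed under adjacency
    and contains a whole component, which is cubic. *)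
Lemma no_cubic_subset (C : {set V}) : C != set0 ->
  exists2 v, v \in C & #|nbhd G v :&: C| < 3.
Proof.
case: G_class => _ _ _ noncubic /set0Pn[x xC].
have [/existsP[v /andP[vC small]] | /existsPn all3] :=
  boolP [exists v, (v \in C) && (#|nbhd G v :&: C| < 3)]; first by exists v.
have full v : v \in C -> nbhd G v \subset C /\ #|nbhd G v| = 3.
  move=> vC; have := all3 v; rewrite vC -leqNgt => le3.
  have eqI : nbhd G v :&: C = nbhd G v.
    by apply/eqP; rewrite eqEcard subsetIl (leq_trans (card_nbhd_le3 v)).
  split; first by rewrite -eqI subsetIr.
  by apply/eqP; rewrite eqn_leq card_nbhd_le3 -{1}eqI.
have adjC : closed (adj G) C.
  apply: intro_closed; first exact/sym_connect_sym/adj_sym.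
  by move=> u v uv /full[/subsetP/(_ v)]; rewrite inE uv => /(_ isT).
pose K := [set y | connect (adj G) x y].
case: (noncubic K).
  apply/imsetP; exists x; rewrite ?inE //.
  by apply/setP=> y; rewrite !inE.
move=> [v vK]; have vC : v \in C.
  by move: vK; rewrite inE => /(closed_connect adjC) <-.
rewrite /degree -(full v vC).2 -(card_imset _ val_inj); congr #|pred_of_set _|.
apply/setP => y; rewrite [RHS]inE; apply/imsetP/idP => [[[u uK]] | vy].
  by rewrite inE => vu ->.
have yK : y \in K by move: vK; rewrite !inE => /connect_trans; apply; apply: connect1.
by exists (Sub y yK); rewrite ?inE.
Qed.

(** Each edge has exactly one end in [A], so the arcs leaving [A] correspond to the edges, and
    equally many arcs leave the complement. *)
Lemma num_arcs_edges : num_arcs G = 2 * #|edges G|.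
Proof.
case: G_class => _ [A bipA] _ _.
have adjF x y : (x \in A) = (y \in A) -> adj G x y = false.
  by move=> eqA; apply/negP => /bipA; rewrite eqA eqxx.
have half : \sum_(x in A) #|nbhd G x| = \sum_(x | x \notin A) #|nbhd G x|.
  transitivity (\sum_(x in A) \sum_(y | y \notin A) adj G x y).
    apply: eq_bigr => x xA; rewrite card_nbhd big_mkcond [RHS]big_mkcond /=.
    by apply: eq_bigr => y _; case: ifP => // /negbFE yA; rewrite adjF ?xA ?yA.
  rewrite exchange_big; apply: eq_bigr => x xA; rewrite card_nbhd big_mkcond /=.
  apply: eq_bigr => y _; rewrite adj_sym; case: ifP => // yA.
  by rewrite adjF ?(negbTE xA).
have -> : num_arcs G = \sum_x #|nbhd G x| by apply: eq_bigr => x _; rewrite card_nbhd.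
rewrite (bigID (mem A)) /= -half addnn -mul2n; congr (2 * _).
pose S := [set p : V * V | adj G p.1 p.2 && (p.1 \in A)].
have -> : edges G = [set [set p.1; p.2] | p in S].
  apply/setP=> F; apply/edgesP/imsetP => [[x [y [xy ->]]] | [[x y]]]; last first.
    by rewrite inE => /andP[xy _] ->; exists x, y.
  case xA: (x \in A); first by exists (x, y); rewrite ?inE ?xy.
  exists (y, x); last exact: setUC.
  by rewrite inE /= adj_sym xy; have := bipA _ _ xy; rewrite xA; case: (y \in A).
rewrite card_in_imset => [|[x y] [u v]].
  rewrite -sum1_card (eq_bigl (fun p : V * V => (p.1 \in A) && adj G p.1 p.2));
    last by move=> p; rewrite inE andbC.
  rewrite -(pair_big_dep (mem A) (fun x y => adj G x y) (fun _ _ => 1)) /=.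
  by apply: eq_bigr => x _; rewrite -sum1_card; apply: eq_bigl => y; rewrite inE.
rewrite !inE /= => /andP[xy xA] /andP[uv uA] eqs.
have := bipA _ _ xy; have := bipA _ _ uv; rewrite xA uA => vA yA.
have xuv : x \in [set u; v] by rewrite -eqs !inE eqxx.
have yuv : y \in [set u; v] by rewrite -eqs !inE eqxx orbT.
move: xuv yuv; rewrite !inE => /orP[] /eqP xe /orP[] /eqP ye; subst=> //.
- by rewrite uA in yA.
- by rewrite xA in vA.
by rewrite xA in vA.
Qed.

(** [no_cubic_subset], applied to the vertices not isolated after the deletion, yields a vertex
    whose remaining degree is 1 or 2. *)
Lemma del_reducible D x y : del D G x y -> reducible (del D G).
Proof.
move=> xy; case: G_class => _ [A bipA] _ _.
have sub u v : del D G u v -> adj G u v by case/and3P.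
have nbhd_sub u : nbhd (del D G) u \subset nbhd G u.
  by apply/subsetP => v; rewrite !inE => /sub.
have [|v vC small] := @no_cubic_subset (nonisolated (del D G)).
  by apply/set0Pn; exists x; rewrite inE; apply/existsP; exists y.
apply: (@reducible_of_small_degree _ _ A _ _ _ _ v).
- by move=> u w; rewrite /del adj_sym; congr (_ && _); exact: andbC.
- by move=> u w /sub/bipA.
- by move=> u; apply: leq_trans (subset_leq_card (nbhd_sub u)) (card_nbhd_le3 u).
- move=> g g_inj gT; apply: (Tstar_free_map g_inj) => i j.
  (* Every vertex of [Tstar] has a neighbour and edges of [del D G] avoid [D]; hence a copy induced
     in [del D G] is induced in [G]. *)
  have gD k : g k \notin D.
    have [l Tkl] : exists l, Tstar_rel k l.
      apply/existsP; case: k => [[|[|[|[|[|[|//]]]]]] k_lt]; apply/existsP.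
      + by exists (Ordinal (isT : 1 < 6)).
      + by exists (Ordinal (isT : 0 < 6)).
      + by exists (Ordinal (isT : 0 < 6)).
      + by exists (Ordinal (isT : 0 < 6)).
      + by exists (Ordinal (isT : 1 < 6)).
      + by exists (Ordinal (isT : 2 < 6)).
    by move: (gT k l); rewrite Tkl => /and3P[].
  by rewrite -gT /del !gD !andbT.
- move: vC; rewrite inE => /existsP[w vw]; rewrite card_gt0; apply/andP; split.
    by apply/set0Pn; exists w; rewrite inE.
  apply: leq_trans small; rewrite ltnS; apply: subset_leq_card; apply/subsetP => u.
  rewrite !inE => vu; rewrite sub //=; apply/existsP; exists v.
  by case/and3P: vu => vu vD uD; rewrite /del adj_sym vu vD uD.
Qed.

(** [profitable] between two stages: passing from the deleted set [D0] to [D] with [j] edges lowers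
    the doubled potential by at least [12 * j]. *)
Definition good D0 j D :=
  12 * j + 8 * #|nonisolated (del D G)| + num_arcs (del D0 G)
    <= 8 * #|nonisolated (del D0 G)| + num_arcs (del D G).

(* The recursion tree of the program [search] below. *)
Fixpoint reach D0 r j D :=
  if r is r'.+1 then
    [exists a, exists b, del D G a b &&
      (good D0 j.+1 ([set a; b] :|: D) || reach D0 r' j.+1 ([set a; b] :|: D))]
  else false.

(** The edges of [W], chosen in order, trace a branch of the recursion tree; as they are disjoint,
    each is still live when its turn comes. *)
Lemma reach_pairs D0 r (W : seq (V * V)) j D : W != [::] -> size W <= r ->
  uniq (endpoints W) -> all (fun p => del D G p.1 p.2) W ->
  good D0 (j + size W) ([set x in endpoints W] :|: D) -> reach D0 r j D.
Proof.
elim: W r j D => [//|[a b] W IHW] [//|r] j D _ /= szW /and3P[a_new b_new uW] /andP[abD W_live].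
move=> goodW; apply/existsP; exists a; apply/existsP; exists b; rewrite abD /=.
case: W => [|p W] in IHW szW a_new b_new uW W_live goodW *; apply/orP; [left|right].
  rewrite -addn1 (_ : [set a; b] = [set x in endpoints [:: (a, b)]]) //.
  by apply/setP => x; rewrite !inE.
apply: IHW => //.
  apply/allP => q qW; have /and3P[q12 q1 q2] := allP W_live q qW.
  have q_in x : x \in [:: q.1; q.2] -> x \in endpoints (p :: W).
    by move=> xq; apply/flattenP; exists [:: q.1; q.2] => //; apply: map_f.
  have q_out x : x \in [:: q.1; q.2] -> x \notin D -> x \notin [set a; b] :|: D.
    move=> /q_in xW xD; rewrite !inE (negbTE xD) orbF; apply/norP; split.
      by apply: contraNneq a_new => <-; rewrite inE xW orbT.
    by apply: contraNneq b_new => <-.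
  by rewrite /del q12 !q_out // !inE eqxx ?orbT.
rewrite addSnnS; have <- // : [set x in endpoints ((a, b) :: p :: W)] :|: D =
  [set x in endpoints (p :: W)] :|: ([set a; b] :|: D).
by apply/setP => x; rewrite !inE; case: (x == a); case: (x == b); rewrite ?orbT.
Qed.

(** The depth 6 is the bound on the size of a reduction. *)
Lemma reach_live D x y : del D G x y -> reach D 6 0 D.
Proof.
move=> /del_reducible[W [W0 szW uW W_live prof]]; apply: (reach_pairs W0 szW uW W_live).
move: prof; rewrite /profitable /good add0n.
by rewrite (eq_nonisolated (delU _ _ _)) (eq_num_arcs (delU _ _ _)) setUC.
Qed.

(** The loop invariant: since the full graph, the potential has dropped by at least 6 per edge of
    [M]. *)
Definition partial M := matching G M && good set0 #|M| (cover M).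

Lemma card_edge F : F \in edges G -> #|F| = 2.
Proof.
case/edgesP => x [y [xy ->]]; rewrite cards2; case: eqP xy => // ->.
by rewrite adj_irr.
Qed.

Lemma add_edge_matching M a b : matching G M -> del (cover M) G a b ->
  [/\ matching G ([set a; b] |: M), cover ([set a; b] |: M) = [set a; b] :|: cover M
    & #|[set a; b] |: M| = #|M|.+1].
Proof.
case/andP=> ME trivM /and3P[ab aM bM].
have dis F : F \in M -> [disjoint [set a; b] & F].
  move=> FM; rewrite disjoint_subset; apply/subsetP => x; rewrite !inE => /orP[]/eqP ->.
    by apply: contra aM => aF; apply/bigcupP; exists F.
  by apply: contra bM => bF; apply/bigcupP; exists F.
have abM : [set a; b] \notin M.
  by apply: contra aM => abM; apply/bigcupP; exists [set a; b]; rewrite // !inE eqxx.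
split; last by rewrite cardsU1 abM.
  rewrite /matching subUset sub1set mem_edges ab ME /=.
  apply/trivIsetP => F F'; rewrite !inE => /orP[/eqP -> | FM] /orP[/eqP -> | F'M] neqF.
  - by rewrite eqxx in neqF.
  - exact: dis.
  - by rewrite disjoint_sym dis.
  - exact: (trivIsetP trivM).
by rewrite /cover big_setU1.
Qed.

(** [j] edges were chosen before the current call, and those of [M'] beyond [M] are added; the
    subtraction is exact since [M'] is larger. *)
Lemma reach_matching D0 r j M : matching G M -> reach D0 r j (cover M) ->
  exists M', [/\ matching G M', #|M| < #|M'| & good D0 (j + #|M'| - #|M|) (cover M')].
Proof.
elim: r j M => // r IHr j M mM /existsP[a /existsP[b /andP[abM]]].
have [mM' <- cM'] := add_edge_matching mM abM.
case/orP=> [gM' | /(IHr _ _ mM')[M'' [mM'' ltM'' gM'']]].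
  exists ([set a; b] |: M); rewrite cM' ltnSn; split=> //.
  by rewrite addnS -addSn addnK.
rewrite cM' in ltM'' gM''; exists M''; split=> //; first exact: ltnW.
Qed.

Lemma good_trans D0 D1 D2 i j : good D0 i D1 -> good D1 j D2 -> good D0 (i + j) D2.
Proof.
have arith (n0 n1 n2 a0 a1 a2 : nat) : 12 * i + 8 * n1 + a0 <= 8 * n0 + a1 ->
    12 * j + 8 * n2 + a1 <= 8 * n1 + a2 -> 12 * (i + j) + 8 * n2 + a0 <= 8 * n0 + a2.
  by lia.
exact: arith.
Qed.

Lemma partial_trans M M' : partial M -> matching G M' -> #|M| < #|M'| ->
  good (cover M) (0 + #|M'| - #|M|) (cover M') -> partial M'.
Proof.
move=> /andP[mM gM] mM' ltM gM'; rewrite /partial mM' /=.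
by have := good_trans gM gM'; rewrite add0n subnKC // ltnW.
Qed.

Lemma partial_extend M x y : partial M -> del (cover M) G x y ->
  exists2 M', partial M' & #|M| < #|M'|.
Proof.
move=> pM; have /andP[mM _] := pM.
move=> /reach_live/(reach_matching mM)[M' [mM' ltM gM']].
by exists M'; rewrite // (partial_trans pM).
Qed.

(** A crude bound, enough to limit the number of rounds. *)
Lemma card_matching_le M : matching G M -> #|M| <= #|V|.
Proof.
case/andP=> /subsetP ME /eqP triv; apply: leq_trans (max_card (mem (cover M))).
rewrite -triv -sum1_card; apply: leq_sum => F /ME FE.
by rewrite (card_edge FE).
Qed.

(** With no live arc left the final potential is 0, so [good] bounds [12 * #|M|] by the initial
    doubled potential, which is at most [8 * #|V| - 2 * #|edges G|]. Every edge meets the cover,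
    whence maximality. *)
Lemma partial_maximal M : partial M -> (forall x y, ~~ del (cover M) G x y) ->
  maximal_matching G M /\ 6 * #|M| + #|edges G| <= 4 * #|V|.
Proof.
case/andP=> mM gM dead; split; last first.
  have ni0 : #|nonisolated (del (cover M) G)| = 0.
    apply/eqP; rewrite cards_eq0; apply/eqP/setP => x; rewrite !inE.
    by apply/negbTE/existsPn => y; apply: dead.
  have na0 : num_arcs (del (cover M) G) = 0.
    by apply: big1 => x _; apply: big1 => y _; rewrite (negbTE (dead x y)).
  move: gM; rewrite /good ni0 na0 (eq_num_arcs (del_set0 _)) num_arcs_edges.
  have := max_card (mem (nonisolated (del set0 G))).
  by move: #|nonisolated _| #|edges G| #|M| #|V| => ni m j n; lia.
apply/maxsetP; split=> // B /andP[BE trivB] MB; apply/eqP.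
rewrite eqEsubset MB andbT; apply/subsetP => F FB.
have /edgesP[x [y [xy defF]]] := subsetP BE F FB.
have : (x \in cover M) || (y \in cover M).
  by have := dead x y; rewrite /del xy /= negb_and !negbK.
(* An edge of the matching [B] that meets an edge of [M], hence of [B], coincides with it. *)
have in_M z : z \in F -> z \in cover M -> F \in M.
  move=> zF /bigcupP[F' F'M zF'].
  case: (eqVneq F F') => [-> // | neqF].
  have /trivIsetP/(_ F F' FB (subsetP MB _ F'M) neqF) := trivB.
  by rewrite disjoint_subset => /subsetP/(_ z zF); rewrite inE zF'.
by case/orP; apply: in_M; rewrite defF !inE eqxx ?orbT.
Qed.

Lemma partial0 : partial set0.
Proof.
rewrite /partial /matching sub0set /cover big_set0 cards0 /good muln0 add0n leqnn andbT.
by apply/trivIsetP => A B; rewrite inE.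
Qed.

(** A largest [partial] matching leaves no live arc, since it could otherwise be extended. *)
Lemma exists_small_maximal_matching :
  exists2 M, maximal_matching G M & 6 * #|M| + #|edges G| <= 4 * #|V|.
Proof.
have [M pM maxM] := @arg_maxnP _ set0 partial (fun M => #|M|) partial0.
have [|?] := partial_maximal pM; last by exists M.
move=> x y; apply/negP => /(partial_extend pM)[M' pM'].
by rewrite ltnNge; apply/negP/negPn/maxM.
Qed.
End Class.

(** * Running time of programs *)

Definition runs (p : prog) (s : state) (T : nat) (Q : state -> Prop) :=
  exists t s', [/\ exec p s t s', t <= T & Q s'].

Lemma runs_weaken p s T T' (Q Q' : state -> Prop) :
  T <= T' -> (forall s', Q s' -> Q' s') -> runs p s T Q -> runs p s T' Q'.
Proof.
move=> TT' QQ' [t [s' [ex tT Qs']]]; exists t, s'; split=> //; last exact: QQ'.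
exact: leq_trans tT TT'.
Qed.

Lemma runs_skip s T (Q : state -> Prop) : 0 < T -> Q s -> runs Skip s T Q.
Proof. by move=> T_gt0 Qs; exists 1, s; split=> //; constructor. Qed.

Lemma runs_set_reg x e s T (Q : state -> Prop) : cost e < T ->
  Q (set_reg s x (eval s e)) -> runs (SetReg x e) s T Q.
Proof. by move=> eT Qs; exists (cost e).+1, (set_reg s x (eval s e)); split=> //; constructor. Qed.

Lemma runs_set_cell a i e s T (Q : state -> Prop) : cost i + cost e < T ->
  Q (set_cell s a (eval s i) (eval s e)) -> runs (SetCell a i e) s T Q.
Proof.
move=> eT Qs; exists (cost i + cost e).+1, (set_cell s a (eval s i) (eval s e)).
by split=> //; constructor.
Qed.

Lemma runs_seq p q s T1 T2 T Q :
  runs p s T1 (fun s' => runs q s' T2 Q) -> T1 + T2 <= T -> runs (Seq p q) s T Q.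
Proof.
move=> [t1 [s1 [ex1 tT1 [t2 [s2 [ex2 tT2 Qs2]]]]]] leT.
exists (t1 + t2), s2; split=> //; first exact: ExecSeq ex1 ex2.
by apply: leq_trans leT; apply: leq_add.
Qed.

(** Truncated subtraction is harmless: [cost e < T - T'] forces [T' + cost e < T]. *)
Lemma runs_if e p q s T T' Q : cost e < T - T' ->
  runs (if eval s e != 0 then p else q) s T' Q -> runs (If e p q) s T Q.
Proof.
move=> eT [t [s' [ex tT Qs']]]; exists ((cost e).+1 + t), s'; split=> //; last by lia.
by case: eqP ex => [e0 | /eqP e0] ex; [apply: ExecIfFalse | apply: ExecIfTrue].
Qed.

Definition For i p :=
  Seq (SetReg i (Defs.Num 0))
    (While (Ltn (Reg i) (Reg 0)) (Seq p (SetReg i (Add (Reg i) (Defs.Num 1))))).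

(** Each iteration spends 4 steps on the test and 4 on the increment; the initialisation takes 2 and
    the last test 4. *)
Definition for_time n T := n * (T + 8) + 6.

(** [Inv v] is required right after the counter receives [v]; the body must leave the counter
    unchanged. *)
Lemma runs_for n i p s T (Inv : nat -> state -> Prop) Q :
  (forall v s, Inv v s -> reg s 0 = n) ->
  (forall v s, v < n -> Inv v s -> reg s i = v ->
     runs p s T (fun s' => reg s' i = v /\ Inv v.+1 (set_reg s' i v.+1))) ->
  Inv 0 (set_reg s i 0) -> (forall s, Inv n s -> Q s) ->
  runs (For i p) s (for_time n T) Q.
Proof.
move=> reg0 body Inv0 InvQ.
have loop k v s1 : n = v + k -> Inv v s1 -> reg s1 i = v ->
    runs (While (Ltn (Reg i) (Reg 0)) (Seq p (SetReg i (Add (Reg i) (Defs.Num 1)))))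
      s1 (k * (T + 8) + 4) Q.
  elim: k v s1 => [|k IHk] v s1 def_n Inv_s reg_i.
    rewrite addn0 in def_n; exists 4, s1; split=> //; last by apply: InvQ; rewrite def_n.
    by apply: ExecWhileFalse; rewrite /= reg_i (reg0 _ _ Inv_s) def_n ltnn.
  have lt_vn : v < n by lia.
  have [t2 [s2 [ex2 t2T [reg2 Inv2]]]] := body v s1 lt_vn Inv_s reg_i.
  have [|//||t3 [s3 [ex3 t3T Qs3]]] := IHk v.+1 (set_reg s2 i v.+1).
  - by rewrite addSnnS.
  - by rewrite /= eqxx.
  have ex_inc : exec (SetReg i (Add (Reg i) (Defs.Num 1))) s2 4 (set_reg s2 i v.+1).
    have -> : v.+1 = eval s2 (Add (Reg i) (Defs.Num 1)) by rewrite /= reg2 addn1.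
    exact: ExecSetReg.
  have cond : eval s1 (Ltn (Reg i) (Reg 0)) != 0 by rewrite /= reg_i (reg0 _ _ Inv_s) lt_vn.
  exists (4 + (t2 + 4) + t3), s3; split=> //; last by lia.
  exact: ExecWhileTrue cond (ExecSeq ex2 ex_inc) ex3.
apply: (@runs_seq _ _ _ 2 (n * (T + 8) + 4)); last by rewrite /for_time; lia.
by apply: runs_set_reg => //=; apply: loop => //=; rewrite eqxx.
Qed.

(** * The program *)

Lemma sum_ord_ltnS n (F : 'I_n -> nat) v (lt_vn : v < n) :
  \sum_(i < n | i < v.+1) F i = \sum_(i < n | i < v) F i + F (Ordinal lt_vn).
Proof.
rewrite (bigD1 (Ordinal lt_vn)) //= addnC; congr (_ + _); apply: eq_bigl => i.
by rewrite ltnS [RHS]ltn_neqAle andbC.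
Qed.

Lemma sum_ord_lt0 n (F : 'I_n -> nat) : \sum_(i < n | i < 0) F i = 0.
Proof. by rewrite big_pred0. Qed.

Lemma sum_ord_ltn n (F : 'I_n -> nat) : \sum_(i < n | i < n) F i = \sum_i F i.
Proof. by apply: eq_bigl => i; rewrite ltn_ord. Qed.

Lemma flat_index_inj n (x y a b : 'I_n) : (x * n + y == a * n + b) = (x == a) && (y == b).
Proof.
apply/eqP/andP => [eq_xy | [/eqP -> /eqP -> //]].
have n_gt0 : 0 < n by apply: leq_ltn_trans (ltn_ord x).
have := congr1 (divn^~ n) eq_xy; have := congr1 (modn^~ n) eq_xy.
rewrite !modnMDl !divnMDl // !modn_small // !divn_small // !addn0 => xa yb.
by split; apply/eqP/val_inj.
Qed.

Lemma adjacency_arrayE n (F : {set {set 'I_n}}) (x y : 'I_n) :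
  adjacency_array F (x * n + y) = ([set x; y] \in F).
Proof.
congr nat_of_bool; apply/existsP/idP => [[a /existsP[b /andP[]]] | xyF].
  by rewrite flat_index_inj => /andP[/eqP -> /eqP ->].
by exists x; apply/existsP; exists y; rewrite eqxx.
Qed.

Section Program.
Variables (n : nat) (G : sgraph 'I_n).
Implicit Types (M : {set {set 'I_n}}) (D : {set 'I_n}) (s : state).

(* Array 2 holds the row offsets [x * n] of the matrices and array 3 marks the
   covered vertices. *)
Record layout s M : Prop := Layout {
  layout_size : reg s 0 = n;
  layout_adj : forall x y : 'I_n, cell s 0 (x * n + y) = adj G x y;
  layout_out : forall x y : 'I_n, cell s 1 (x * n + y) = ([set x; y] \in M);
  layout_row : forall x : 'I_n, cell s 2 x = x * n;
  layout_cover : forall x : 'I_n, cell s 3 x = (x \in cover M) }.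

Lemma layout_frame s s' M :
  cell s' = cell s -> reg s' 0 = reg s 0 -> layout s M -> layout s' M.
Proof. by move=> eqc eqr [*]; split; rewrite ?eqc ?eqr. Qed.

(** The adjacency entry is at most 1, so it exceeds the sum of the two cover marks only for an edge
    with both ends uncovered. *)
Definition live_edge a b :=
  Ltn (Add (Cell 3 (Reg a)) (Cell 3 (Reg b)))
      (Cell 0 (Add (Cell 2 (Reg a)) (Reg b))).

Lemma eval_live_edge s M a b (x y : 'I_n) :
  layout s M -> reg s a = x -> reg s b = y ->
  eval s (live_edge a b) = del (cover M) G x y.
Proof.
move=> lay sa sb; rewrite /= sa sb !(layout_cover lay) (layout_row lay) (layout_adj lay).
by rewrite /del; case: (adj G x y) (x \in _) (y \in _) => [] [] [].
Qed.

(* Leaves 8 times the number of non-isolated uncovered vertices in register 5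
   and the number of live arcs in register 6. *)
Definition measure :=
  Seq (SetReg 5 (Defs.Num 0)) (Seq (SetReg 6 (Defs.Num 0)) (For 2 (
    Seq (SetReg 4 (Defs.Num 0)) (Seq (For 3 (
      If (live_edge 2 3)
        (Seq (SetReg 6 (Add (Reg 6) (Defs.Num 1))) (SetReg 4 (Defs.Num 1))) Skip))
    (If (Reg 4) (SetReg 5 (Add (Reg 5) (Defs.Num 8))) Skip))))).

(** The 18 is the inner body: 12 steps for testing [live_edge], 6 for the two assignments. *)
Definition measure_time n := for_time n (for_time n 18 + 10) + 4.

Definition measured D s :=
  reg s 5 = 8 * #|nonisolated (del D G)| /\ reg s 6 = num_arcs (del D G).

Lemma card_nonisolated_sum (e : rel 'I_n) :
  #|nonisolated e| = \sum_x (0 < \sum_y e x y).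
Proof.
rewrite -sum1_card big_mkcond; apply: eq_bigr => x _; rewrite inE -card_nbhd lt0n cards_eq0.
suff -> : [exists y, e x y] = (nbhd e x != set0) by case: (_ != _).
by apply/existsP/set0Pn => -[y xy]; exists y; rewrite ?inE // inE in xy *.
Qed.

Lemma runs_measure s M T Q :
  layout s M -> measure_time n <= T ->
  (forall s', cell s' = cell s ->
     (forall k, (k < 2) || (6 < k) -> reg s' k = reg s k) ->
     measured (cover M) s' -> Q s') ->
  runs measure s T Q.
Proof.
move=> lay leT post; set e := del (cover M) G in post *.
pose c x := \sum_y e x y.
pose frame s' := cell s' = cell s /\ forall k, (k < 2) || (6 < k) -> reg s' k = reg s k.
have frame_set s' i v : 2 <= i <= 6 -> frame s' -> frame (set_reg s' i v).
  move=> i26 [eqc eqr]; split=> // k k_out /=.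
  by rewrite ifF; [exact: eqr | lia].
have frame_layout s' : frame s' -> layout s' M.
  by move=> [eqc eqr]; apply: layout_frame eqc _ lay; rewrite eqr.
pose outer v s' := [/\ frame s', reg s' 5 = 8 * \sum_(x < n | x < v) (0 < c x)
  & reg s' 6 = \sum_(x < n | x < v) c x].
apply: (@runs_seq _ _ _ 2 (measure_time n - 2)); last by rewrite /measure_time in leT *; lia.
apply: runs_set_reg => //; apply: (@runs_seq _ _ _ 2 (measure_time n - 4));
  last by rewrite /measure_time; lia.
apply: runs_set_reg => //.
apply: (@runs_weaken _ _ (for_time n (for_time n 18 + 10)) _ Q Q) => //.
  by rewrite /measure_time; lia.
apply: (@runs_for n _ _ _ _ outer).
- by move=> v s' [/frame_layout/layout_size].
- move=> v s1 lt_vn [fr1 r5 r6] r2; pose x := Ordinal lt_vn.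
  (* Register 4 flags whether row [v] has shown a live arc so far. *)
  pose inner w s' := [/\ frame s', reg s' 2 = v, reg s' 5 = reg s1 5,
    reg s' 6 = reg s1 6 + \sum_(y < n | y < w) e x y
    & reg s' 4 = (0 < \sum_(y < n | y < w) e x y)].
  apply: (@runs_seq _ _ _ 2 (for_time n 18 + 8)); last by lia.
  apply: runs_set_reg => //; apply: (@runs_seq _ _ _ (for_time n 18) 8); last by lia.
  apply: (@runs_for n _ _ _ _ inner).
  + by move=> w s' [/frame_layout/layout_size].
  + move=> w s2 lt_wn [fr2 q2 q5 q6 q4] q3; pose y := Ordinal lt_wn.
    apply: (@runs_if _ _ _ _ _ 6) => //.
    rewrite (eval_live_edge (x := x) (y := y) (frame_layout _ fr2) q2 q3) -/e.
    case exy: (e x y) => /=.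
      apply: (@runs_seq _ _ _ 4 2) => //; apply: runs_set_reg => //; apply: runs_set_reg => //.
      split; first by rewrite /= q3.
      split=> //=; first by do 3 (apply: (frame_set) => //).
        by rewrite (sum_ord_ltnS _ lt_wn) -/y exy q6 addnA.
      by rewrite (sum_ord_ltnS _ lt_wn) -/y exy addn1.
    apply: runs_skip => //; split=> //; split=> //=; first exact: frame_set.
      by rewrite (sum_ord_ltnS _ lt_wn) -/y exy addn0.
    by rewrite (sum_ord_ltnS _ lt_wn) -/y exy addn0.
  + split=> //=; rewrite ?sum_ord_lt0 ?addn0 //.
    by do 2 (apply: (frame_set) => //).
  move=> s2 [fr2 q2 q5 q6 q4]; rewrite sum_ord_ltn -/(c x) in q6 q4.
  apply: (@runs_if _ _ _ _ _ 5) => //=; rewrite q4.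
  case cx: (0 < c x) => /=.
    apply: runs_set_reg => //; split=> //=.
    split=> /=; first by do 2 (apply: (frame_set) => //).
      by rewrite (sum_ord_ltnS _ lt_vn) -/x cx q5 r5 mulnDr.
    by rewrite (sum_ord_ltnS _ lt_vn) -/x q6 r6.
  apply: runs_skip => //; split=> //; split=> /=; first exact: frame_set.
    by rewrite (sum_ord_ltnS _ lt_vn) -/x cx q5 r5 addn0.
  by rewrite (sum_ord_ltnS _ lt_vn) -/x q6 r6.
- split=> /=; rewrite ?sum_ord_lt0 ?muln0 //.
  by do 3 (apply: (frame_set) => //); split.
move=> s' [[eqc eqr] r5 r6]; rewrite !sum_ord_ltn in r5 r6.
by apply: post => //; rewrite /measured card_nonisolated_sum.
Qed.
End Program.

Lemma eq_set2 (T : finType) (z w x y : T) :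
  ([set z; w] == [set x; y]) = (z == x) && (w == y) || (z == y) && (w == x).
Proof.
apply/eqP/orP => [eq2 | [] /andP[/eqP -> /eqP ->] //]; last exact: setUC.
have zxy : z \in [set x; y] by rewrite -eq2 !inE eqxx.
have wxy : w \in [set x; y] by rewrite -eq2 !inE eqxx orbT.
have xzw : x \in [set z; w] by rewrite eq2 !inE eqxx.
have yzw : y \in [set z; w] by rewrite eq2 !inE eqxx orbT.
move: zxy wxy xzw yzw; rewrite !inE !(eq_sym x) !(eq_sym y).
by case: (z == x); case: (z == y); case: (w == x); case: (w == y) => //=; auto.
Qed.

(** * Backtracking search for a reduction *)

Section Search.
Variables (n : nat) (G : sgraph 'I_n).
Implicit Types (M : {set {set 'I_n}}) (D : {set 'I_n}) (s : state).

(** Adds the edge to the output when [v] is true and retracts it when false; both symmetric matrix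
    entries are written. *)
Definition toggle a b (v : bool) :=
  Seq (SetCell 3 (Reg a) (Defs.Num v)) (Seq (SetCell 3 (Reg b) (Defs.Num v))
  (Seq (SetCell 1 (Add (Cell 2 (Reg a)) (Reg b)) (Defs.Num v))
       (SetCell 1 (Add (Cell 2 (Reg b)) (Reg a)) (Defs.Num v)))).

Lemma runs_toggle s M M' a b (x y : 'I_n) v T (Q : state -> Prop) :
  layout G s M -> reg s a = x -> reg s b = y -> 18 <= T ->
  (forall z, (z \in cover M') = if z \in [set x; y] then v else z \in cover M) ->
  (forall z w, ([set z; w] \in M')
     = if [set z; w] == [set x; y] then v else [set z; w] \in M) ->
  (forall s', reg s' = reg s -> layout G s' M' -> Q s') ->
  runs (toggle a b v) s T Q.
Proof.
move=> lay sa sb T18 covM' M'E post.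
apply: (@runs_seq _ _ _ 3 15) => //; apply: runs_set_cell => //=.
apply: (@runs_seq _ _ _ 3 12) => //; apply: runs_set_cell => //=.
apply: (@runs_seq _ _ _ 6 6) => //; apply: runs_set_cell => //=.
apply: runs_set_cell => //=; apply: post => //.
rewrite !sa !sb /= !(layout_row lay).
split=> [|z w|z w|z|z] /=.
- by rewrite (layout_size lay).
- by rewrite (layout_adj lay).
- rewrite M'E !flat_index_inj eq_set2 (layout_out lay).
  by case: (z == x) (w == y) (z == y) (w == x) => [] [] [] [].
- by rewrite (layout_row lay).
- rewrite covM' !inE (layout_cover lay) -!val_eqE /=.
  by case: (_ == _); case: (_ == _).
Qed.

(* Registers 7 and 8 hold the result of [measure] before the first of the [j]
   edges chosen so far was added; register 1 is set once a reduction is found. *)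
Fixpoint search r j :=
  if r is r'.+1 then
    let a := 9 + 2 * r' in let b := 10 + 2 * r' in
    For a (For b (
      If (Reg 1) Skip (If (live_edge a b)
        (Seq (toggle a b true) (Seq measure (Seq
          (SetReg 1 (Ltn (Add (Defs.Num (12 * j.+1)) (Add (Reg 5) (Reg 8)))
                         (Add (Add (Reg 7) (Reg 6)) (Defs.Num 1))))
          (Seq (If (Reg 1) Skip (search r' j.+1))
               (If (Reg 1) Skip (toggle a b false))))))
        Skip)))
  else Skip.

Fixpoint search_time n r :=
  if r is r'.+1 then for_time n (for_time n (search_time n r' + measure_time n + 100)) else 1.

(** Either a reduction was found and its edges are in memory, or every trial was undone and [missed]
    states which choices are excluded. *)
Definition outcome D0 j M (missed : Prop) s := exists M',
  [/\ layout G s M', matching G M'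
    & [/\ reg s 1 = 1, #|M| < #|M'| & good G D0 (j + #|M'| - #|M|) (cover M')]
      \/ [/\ reg s 1 = 0, M' = M & missed]].

(** Kept are the order, the reference values in registers 7 and 8, and the counters of the enclosing
    levels: [search r] uses counters from 9 to [8 + 2 * r]. *)
Definition frame r s s' :=
  forall k, [|| k == 0, 6 < k < 9 | 9 + 2 * r <= k] -> reg s' k = reg s k.

Lemma outcome_set_reg D0 j M (P P' : Prop) s i v : 1 < i -> (P -> P') ->
  outcome D0 j M P s -> outcome D0 j M P' (set_reg s i v).
Proof.
move=> i_gt1 PP' [M' [lay mM' res]]; exists M'; split=> //.
  by apply: layout_frame lay => //=; rewrite ifF //; lia.
rewrite /= ifF; last by lia.
by case: res => [|[? ? /PP']]; [left | right].
Qed.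

Lemma frame_set_reg r s s' i v : 9 <= i < 9 + 2 * r -> frame r s s' ->
  frame r s (set_reg s' i v).
Proof. by move=> i_bnd fr k k_out; rewrite /= ifF; [exact: fr | lia]. Qed.

Lemma frame_trans r s1 s2 s3 : frame r s1 s2 -> frame r s2 s3 -> frame r s1 s3.
Proof. by move=> fr12 fr23 k k_out; rewrite fr23 ?fr12. Qed.

Lemma frameS r s s' : frame r s s' -> frame r.+1 s s'.
Proof. by move=> fr k k_out; apply: fr; lia. Qed.

Lemma search_time_gt0 r : 0 < search_time n r.
Proof. by case: r => //= r; rewrite /for_time; lia. Qed.

(** One trial of the edge [xy], with the recursive call abstracted to a program [p] satisfying the
    induction hypothesis of the search. *)
Lemma runs_try r j M D0 s a b (x y : 'I_n) p T :
  (forall s M, layout G s M -> matching G M ->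
     reg s 1 = 0 -> reg s 7 = 8 * #|nonisolated (del D0 G)| ->
     reg s 8 = num_arcs (del D0 G) ->
     runs p s T (fun s' => frame r s s' /\
       outcome D0 j.+1 M (~~ reach G D0 r j.+1 (cover M)) s')) ->
  0 < T -> 9 + 2 * r <= a -> 9 + 2 * r <= b ->
  layout G s M -> matching G M -> reg s 1 = 0 ->
  reg s 7 = 8 * #|nonisolated (del D0 G)| -> reg s 8 = num_arcs (del D0 G) ->
  reg s a = x -> reg s b = y -> del (cover M) G x y ->
  runs (Seq (toggle a b true) (Seq measure (Seq
          (SetReg 1 (Ltn (Add (Defs.Num (12 * j.+1)) (Add (Reg 5) (Reg 8)))
                         (Add (Add (Reg 7) (Reg 6)) (Defs.Num 1))))
          (Seq (If (Reg 1) Skip p) (If (Reg 1) Skip (toggle a b false))))))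
    s (T + measure_time n + 60)
    (fun s' => frame r s s' /\ outcome D0 j M
      (~~ (good G D0 j.+1 ([set x; y] :|: cover M)
           || reach G D0 r j.+1 ([set x; y] :|: cover M))) s').
Proof.
move=> run_p T_gt0 ra rb lay mM s1 s7 s8 sa sb xyM.
have [mM1 covM1 cardM1] := add_edge_matching mM xyM.
set M1 := [set x; y] |: M in mM1 covM1 cardM1 *.
have xyM' : [set x; y] \notin M.
  by apply: contraTN (leqnn #|M1|) => xyM'; rewrite {1}cardM1 /M1 (setUidPr _) ?sub1set // ltnn.
apply: (@runs_seq _ _ _ 18 (T + measure_time n + 40)); last by lia.
apply: (@runs_toggle _ M M1 _ _ x y) => // [z|z w|s2 eqr2 lay2].
- by rewrite covM1 in_setU; case: (z \in [set x; y]).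
- by rewrite !inE; case: (_ == _).
apply: (@runs_seq _ _ _ (measure_time n) (T + 40)); last by lia.
apply: (runs_measure lay2) => // s3 eqc3 eqr3 [m5 m6].
rewrite covM1 in m5 m6.
have reg3 k : (k < 2) || (6 < k) -> reg s3 k = reg s k.
  by move=> k_out; rewrite eqr3 // eqr2.
have lay3 : layout G s3 M1 by apply: layout_frame lay2 => //; exact: eqr3.
apply: (@runs_seq _ _ _ 12 (T + 28)); last by lia.
apply: runs_set_reg => //=; rewrite m5 m6 !reg3 // s7 s8.
(* The added 1 in the test turns its strict comparison into the weak inequality of [good]. *)
set g := (X in nat_of_bool X).
have -> : g = good G D0 j.+1 ([set x; y] :|: cover M).
  by rewrite /g addn1 ltnS addnA.
set s4 := set_reg _ _ _.
have fr4 : frame r s s4.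
  by move=> k k_out; rewrite /= ifF ?reg3 //; lia.
have lay4 : layout G s4 M1 by apply: layout_frame lay3.
have s4ab k : 9 <= k -> reg s4 k = reg s k by move=> k9; rewrite /= ifF ?reg3 //; lia.
have s41 : reg s4 1 = good G D0 j.+1 ([set x; y] :|: cover M) by [].
clearbody s4; apply: (@runs_seq _ _ _ (T + 3) 24); last by lia.
apply: (@runs_if _ _ _ _ _ T); first by rewrite /=; lia.
rewrite [eval _ _]/= s41; case: (boolP (good _ _ _ _)) s41 => gM1 s41.
  apply: runs_skip => //; apply: (@runs_if _ _ _ _ _ 20) => //=; rewrite s41 /=.
  apply: runs_skip => //; split=> //.
  exists M1; split=> //; left; split; rewrite ?cardM1 ?covM1 //.
  by rewrite addnS -addSn addnK.
have s47 : reg s4 7 = 8 * #|nonisolated (del D0 G)| by rewrite fr4.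
have s48 : reg s4 8 = num_arcs (del D0 G) by rewrite fr4.
have [t [s5 [ex5 t5 [fr5 [M2 [lay5 mM2 out5]]]]]] := run_p s4 M1 lay4 mM1 s41 s47 s48.
exists t, s5; split=> //; case: out5 => [[s51 ltM gM2] | [s50 defM2 miss]].
  apply: (@runs_if _ _ _ _ _ 20) => //=; rewrite s51 /=.
  apply: runs_skip => //; split; first exact: frame_trans fr5.
  exists M2; split=> //; left; rewrite cardM1 in ltM gM2; split=> //; first exact: ltnW.
rewrite defM2 in lay5 *; apply: (@runs_if _ _ _ _ _ 20) => //=; rewrite s50 /=.
have reg5 k : 9 + 2 * r <= k -> reg s5 k = reg s k.
  by move=> k_out; rewrite fr5 ?s4ab //; lia.
apply: (@runs_toggle _ M1 M _ _ x y) => //; rewrite ?reg5 //.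
- move=> z; rewrite covM1 [z \in _ :|: cover M]in_setU.
  case: (boolP (z \in [set x; y])) => [zxy | _] //=.
  case/and3P: xyM => _ xM yM; move: zxy; rewrite !inE.
  by case/orP => /eqP ->; apply: negbTE.
- move=> z w; rewrite !inE; case: eqP => [-> | //]; exact: negbTE.
move=> s6 eqr6 lay6; split; first by move=> k k_out; rewrite eqr6 fr5 ?fr4.
exists M; split=> //; right; split=> //; first by rewrite eqr6.
by rewrite -covM1.
Qed.

(** If register 1 stays unset, the loops have rejected every pair, which is the negation of
    [reach]. *)
Lemma runs_search r j M D0 s :
  layout G s M -> matching G M -> reg s 1 = 0 ->
  reg s 7 = 8 * #|nonisolated (del D0 G)| -> reg s 8 = num_arcs (del D0 G) ->
  runs (search r j) s (search_time n r)
    (fun s' => frame r s s' /\ outcome D0 j M (~~ reach G D0 r j (cover M)) s').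
Proof.
elim: r j M s => [|r IHr] j M s lay mM s1 s7 s8.
  by apply: runs_skip => //; split=> //; exists M; split=> //; right.
rewrite [search _ _]/= [search_time _ _]/=; set a := 9 + _; set b := 10 + _.
pose hit (x y : 'I_n) := del (cover M) G x y &&
  (good G D0 j.+1 ([set x; y] :|: cover M) || reach G D0 r j.+1 ([set x; y] :|: cover M)).
pose outer v s' := frame r.+1 s s' /\
  outcome D0 j M (forall x y : 'I_n, x < v -> ~~ hit x y) s'.
apply: (@runs_for n _ _ _ _ outer).
- by move=> v s' [fr _]; rewrite fr // (layout_size lay).
- move=> v s2 lt_vn [fr2 out2] s2a; pose x := Ordinal lt_vn.
  (* The excluded pairs are those lexicographically before [(v, w)]. *)
  pose inner w s' := [/\ frame r.+1 s s', reg s' a = v & outcome D0 j M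
    (forall x' y : 'I_n, (x' < v) || (x' == x) && (y < w) -> ~~ hit x' y) s'].
  apply: (@runs_for n _ _ _ _ inner).
  + by move=> w s' [fr _ _]; rewrite fr // (layout_size lay).
  + move=> w s3 lt_wn [fr3 s3a [M' [lay3 mM' out3]]] s3b; pose y := Ordinal lt_wn.
    have inner_next s' : reg s' b = w -> frame r.+1 s s' -> reg s' a = v ->
        outcome D0 j M (forall x' y' : 'I_n,
          (x' < v) || (x' == x) && (y' < w.+1) -> ~~ hit x' y') s' ->
        reg s' b = w /\ inner w.+1 (set_reg s' b w.+1).
      move=> s'b fr' s'a out'; split=> //; split.
      * by apply: frame_set_reg fr'; rewrite /b; lia.
      * by rewrite /= ifF // /a /b; lia.
      * by apply: outcome_set_reg out'.
    apply: (@runs_if _ _ _ _ _ (search_time n r + measure_time n + 90)).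
      by rewrite [cost _]/=; lia.
    case: out3 => [found3 | [s31 defM' miss3]].
      have [s31 _ _] := found3; rewrite [eval _ _]/= s31 /=.
      apply: runs_skip; first by lia.
      by apply: inner_next => //; exists M'; split=> //; left.
    rewrite {M'}defM' in lay3 mM' *; rewrite [eval _ _]/= s31 /=.
    apply: (@runs_if _ _ _ _ _ (search_time n r + measure_time n + 60)).
      by rewrite [cost _]/=; lia.
    rewrite (eval_live_edge (x := x) (y := y) lay3 s3a s3b).
    have miss_next : ~~ hit x y -> forall x' y' : 'I_n,
        (x' < v) || (x' == x) && (y' < w.+1) -> ~~ hit x' y'.
      move=> miss_xy x' y' /orP[x'v | /andP[/eqP -> ]]; first by apply: miss3; rewrite x'v.
      rewrite ltnS leq_eqVlt => /orP[/eqP eq_w | y'w].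
        by rewrite (_ : y' = y) //; apply: val_inj.
      by apply: miss3; rewrite eqxx y'w orbT.
    case xyM: (del (cover M) G x y); last first.
      apply: runs_skip; first by lia.
      apply: inner_next => //; exists M; split=> //; right; split=> //.
      by apply: miss_next; rewrite /hit xyM.
    apply: runs_weaken (leqnn _) _ (@runs_try r j M D0 s3 a b x y _ (search_time n r)
      _ (search_time_gt0 r) _ _ lay3 mM s31 _ _ s3a s3b xyM) => //.
    * move=> s4 [fr4 out4]; apply: inner_next.
      - by rewrite fr4 // /b; lia.
      - exact: frame_trans fr3 (frameS fr4).
      - by rewrite fr4 // /a; lia.
      case: out4 => M' [lay4 mM4 [found | [s41 defM' miss4]]]; exists M'; split=> //.
        by left.
      by right; split=> //; apply: miss_next; rewrite /hit xyM.
    * by move=> s4 M4; apply: IHr.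
    * by rewrite fr3.
    * by rewrite fr3.
  + split.
    * by apply: frame_set_reg fr2; rewrite /b; lia.
    * by rewrite /= ifF // /a /b; lia.
    * apply: outcome_set_reg out2 => // miss x' y'.
      by rewrite ltn0 andbF orbF; apply: miss.
  move=> s3 [fr3 s3a out3]; split=> //; split.
    by apply: frame_set_reg fr3; rewrite /a; lia.
  apply: outcome_set_reg out3 => // miss x' y' x'v; apply: miss.
  move: x'v; rewrite ltnS leq_eqVlt -val_eqE /= => /orP[-> | -> //].
  by rewrite ltn_ord orbT.
- split; first by apply: frame_set_reg; rewrite /a //; lia.
  apply: (@outcome_set_reg _ _ _ True) => //.
  by exists M; split=> //; right.
move=> s' [fr [M' [lay' mM' out']]]; split=> //; exists M'; split=> //.
case: out' => [found | [s'1 defM' miss]]; [by left | right; split=> //].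
apply/existsPn => x; apply/existsPn => y; exact: miss.
Qed.
End Search.

(** * The complete greedy algorithm *)

Definition init_rows :=
  Seq (SetReg 3 (Defs.Num 0)) (For 2
    (Seq (SetCell 2 (Reg 2) (Reg 3)) (SetReg 3 (Add (Reg 3) (Reg 0))))).

Definition greedy_round :=
  Seq measure (Seq (SetReg 7 (Reg 5)) (Seq (SetReg 8 (Reg 6))
    (Seq (SetReg 1 (Defs.Num 0)) (search 6 0)))).

Definition greedy :=
  Seq init_rows (Seq (SetReg 1 (Defs.Num 1)) (While (Reg 1) greedy_round)).

Definition round_time n := measure_time n + search_time n 6 + 6.

(** Every round but the last enlarges the matching, which has at most [n] edges; hence the factor
    [n.+1]. *)
Definition greedy_time n := for_time n 7 + n.+1 * (round_time n + 2) + 6.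

Section Greedy.
Variables (n : nat) (G : sgraph 'I_n).
Hypothesis G_class : subcubic_class G.
Implicit Types (M : {set {set 'I_n}}) (s : state).

Definition exhausted M := forall x y, ~~ del (cover M) G x y.

Lemma runs_init_rows T Q :
  for_time n 7 + 2 <= T -> (forall s, layout G s set0 -> Q s) ->
  runs init_rows (input G) T Q.
Proof.
move=> leT post; apply: (@runs_seq _ _ _ 2 (for_time n 7)); last by lia.
apply: runs_set_reg => //=.
(* Register 3 accumulates [v * n] by repeated addition, as the machine has no multiplication. *)
pose rows v s := [/\ reg s 0 = n, reg s 3 = v * n, forall x, x < v -> cell s 2 x = x * n
  & forall a i, a != 2 -> cell s a i = cell (input G) a i].
apply: (@runs_for n _ _ _ _ rows).
- by move=> v s [].
- move=> v s lt_vn [s0 s3 rows_v eqc] s2.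
  apply: (@runs_seq _ _ _ 3 4) => //; apply: runs_set_cell => //=; apply: runs_set_reg => //=.
  split=> //; split=> /= [||x|a i a2]; rewrite ?s0 ?s3 ?mulSnr //.
    rewrite ltnS leq_eqVlt s2 => /orP[/eqP -> | xv]; first by rewrite eqxx.
    by rewrite ltn_eqF // rows_v.
  by rewrite (negbTE a2) /= eqc.
- by split.
move=> s [s0 _ rows_n eqc]; apply: post; split=> // [x y|x y|x|x].
- by rewrite eqc //= adjacency_arrayE mem_edges.
- by rewrite eqc //= inE.
- by rewrite rows_n.
by rewrite eqc //= /cover big_set0 inE.
Qed.

(** If the search fails, [reach_live] shows that no live arc is left. *)
Lemma runs_greedy_round M s : layout G s M -> partial G M ->
  runs greedy_round s (round_time n) (fun s' => exists M',
    [/\ layout G s' M', partial G M'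
      & reg s' 1 = 1 /\ #|M| < #|M'| \/ reg s' 1 = 0 /\ exhausted M']).
Proof.
move=> lay pM; have /andP[mM _] := pM.
apply: (@runs_seq _ _ _ (measure_time n) (search_time n 6 + 6)); last by rewrite /round_time; lia.
apply: (runs_measure lay) => // s1 eqc1 eqr1 [s15 s16].
apply: (@runs_seq _ _ _ 2 (search_time n 6 + 4)); last by lia.
apply: runs_set_reg => //; apply: (@runs_seq _ _ _ 2 (search_time n 6 + 2)); last by lia.
apply: runs_set_reg => //; apply: (@runs_seq _ _ _ 2 (search_time n 6)); last by lia.
apply: runs_set_reg => //.
set s2 := set_reg _ _ _.
have lay2 : layout G s2 M by apply: layout_frame lay => //; apply: eqr1.
apply: runs_weaken (leqnn _) _ (runs_search 6 0 lay2 mM _ s15 s16) => // s3 [_].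
case=> M' [lay3 mM' [[s31 ltM gM'] | [s31 defM' miss]]]; exists M'; split=> //.
- exact: partial_trans gM'.
- by left.
- by rewrite defM'.
right; rewrite defM'; split=> // x y; apply/negP => xyM.
by rewrite (reach_live G_class xyM) in miss.
Qed.

Lemma runs_greedy : runs greedy (input G) (greedy_time n) (fun s =>
  exists M, [/\ layout G s M, partial G M & exhausted M]).
Proof.
apply: (@runs_seq _ _ _ (for_time n 7 + 2) (n.+1 * (round_time n + 2) + 4));
  last by rewrite /greedy_time; lia.
apply: runs_init_rows => // s lay.
apply: (@runs_seq _ _ _ 2 (n.+1 * (round_time n + 2) + 2)); last by lia.
apply: runs_set_reg => //.
(* [k] bounds the remaining rounds; [k = 0] would mean a matching with more than [n] edges. *)
have loop k s1 M : partial G M -> n < #|M| + k -> layout G s1 M -> reg s1 1 = 1 ->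
    runs (While (Reg 1) greedy_round) s1 (k * (round_time n + 2) + 2)
      (fun s' => exists M', [/\ layout G s' M', partial G M' & exhausted M']).
  elim: k s1 M => [|k IHk] s1 M pM lt_n lay1 s11.
    have /andP[mM _] := pM; have := card_matching_le mM.
    by rewrite card_ord leqNgt; move: lt_n; rewrite addn0 => ->.
  have [t1 [s2 [ex1 t1T [M' [lay2 pM' res]]]]] := runs_greedy_round lay1 pM.
  have cond : eval s1 (Reg 1) != 0 by rewrite /= s11.
  case: res => [[s21 ltM] | [s20 exh]]; last first.
    exists (2 + t1 + 2), s2; split; last by exists M'.
      by apply: (ExecWhileTrue cond ex1); apply: ExecWhileFalse.
    by rewrite mulSn; lia.
  have [|t2 [s3 [ex2 t2T fin]]] := IHk s2 M' pM' _ lay2 s21; first by lia.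
  exists (2 + t1 + t2), s3; split=> //; first exact: (ExecWhileTrue cond ex1 ex2).
  by rewrite mulSn; lia.
apply: loop (partial0 G) _ _ _ => //; first by rewrite cards0.
exact: layout_frame lay.
Qed.
End Greedy.

(** * Polynomial bounds *)

Definition poly_bounded (T : nat -> nat) := exists c d, forall n, T n <= c * n.+1 ^ d.

Lemma poly_boundedC c : poly_bounded (fun=> c).
Proof. by exists c, 0 => n; rewrite muln1. Qed.

Lemma poly_bounded_id : poly_bounded id.
Proof. by exists 1, 1 => n; rewrite mul1n expn1. Qed.

Lemma poly_boundedD T1 T2 : poly_bounded T1 -> poly_bounded T2 -> poly_bounded (fun n => T1 n + T2 n).
Proof.
move=> [c1 [d1 le1]] [c2 [d2 le2]]; exists (c1 + c2), (d1 + d2) => n.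
rewrite mulnDl; apply: leq_add.
  by apply: leq_trans (le1 n) _; rewrite leq_mul2l leq_pexp2l ?leq_addr ?orbT.
by apply: leq_trans (le2 n) _; rewrite leq_mul2l leq_pexp2l ?leq_addl ?orbT.
Qed.

Lemma poly_boundedM T1 T2 : poly_bounded T1 -> poly_bounded T2 -> poly_bounded (fun n => T1 n * T2 n).
Proof.
move=> [c1 [d1 le1]] [c2 [d2 le2]]; exists (c1 * c2), (d1 + d2) => n.
by rewrite expnD mulnACA; apply: leq_mul.
Qed.

Lemma poly_bounded_for T : poly_bounded T -> poly_bounded (fun n => for_time n (T n)).
Proof.
move=> pT; apply: poly_boundedD (poly_boundedC 6); apply: poly_boundedM poly_bounded_id _.
exact: poly_boundedD pT (poly_boundedC 8).
Qed.

Lemma poly_bounded_measure : poly_bounded measure_time.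
Proof.
apply: poly_boundedD (poly_boundedC 4); apply: poly_bounded_for.
by apply: poly_boundedD (poly_boundedC 10); apply: poly_bounded_for; apply: poly_boundedC.
Qed.

(** The exponent grows with [r], which the algorithm fixes to 6. *)
Lemma poly_bounded_search r : poly_bounded (search_time^~ r).
Proof.
elim: r => [|r IHr]; first exact: poly_boundedC.
do 2 apply: poly_bounded_for; apply: poly_boundedD (poly_boundedC 100).
exact: poly_boundedD IHr poly_bounded_measure.
Qed.

Lemma poly_bounded_greedy : poly_bounded greedy_time.
Proof.
apply: poly_boundedD (poly_boundedC 6); apply: poly_boundedD.
  by apply: poly_bounded_for; apply: poly_boundedC.
apply: poly_boundedM.
  exact: poly_boundedD (poly_boundedC 1) poly_bounded_id.
apply: poly_boundedD (poly_boundedC 2); apply: poly_boundedD (poly_boundedC 6).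
exact: poly_boundedD poly_bounded_measure (poly_bounded_search 6).
Qed.

(** * The rational bound for both claims *)

Import Order.TTheory GRing.Theory Num.Theory.
Local Open Scope ring_scope.

Lemma le_rat_bound (k m n : nat) : (6 * k + m <= 4 * n)%N ->
  k%:R <= 2 * n%:R / 3 - m%:R / 6 :> rat.
Proof. by rewrite -(ler_nat rat) natrD !natrM; lra. Qed.

Theorem theorem5 :
  (forall (V : finType) (G : sgraph V), subcubic_class G ->
     (edge_domination_number G)%:R
       <= 2 * #|V|%:R / 3 - #|edges G|%:R / 6 :> rat)
  /\
  poly_time_solvable
    (fun (n : nat) (G : sgraph 'I_n) => subcubic_class G)
    (fun (n : nat) (G : sgraph 'I_n) (M : {set {set 'I_n}}) =>
       maximal_matching G M /\
       (#|M|%:R <= 2 * n%:R / 3 - #|edges G|%:R / 6 :> rat)).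
Proof.
split=> [V G G_class|].
  have [M maxM leM] := exists_small_maximal_matching G_class.
  apply: le_rat_bound; apply: leq_trans leM; rewrite leq_add2r leq_mul2l /=.
  rewrite /edge_domination_number; case: ex_minnP => k _; apply.
  by apply/existsP; exists M; rewrite maxM eqxx.
have [c [d time_le]] := poly_bounded_greedy; exists greedy, c, d => n G G_class.
have [t [s [ex tT [M [lay pM exh]]]]] := runs_greedy G_class.
have [maxM leM] := partial_maximal G_class pM exh; rewrite card_ord in leM.
exists t, s, M; split=> //; first exact: leq_trans tT (time_le n).
  (* An index below [n * n] splits into row [k %/ n] and column [k %% n], both below [n]. *)
  move=> k lt_k; have n_gt0 : (0 < n)%N by case: (n) lt_k.
  have lt_q : (k %/ n < n)%N by rewrite ltn_divLR.
  have lt_r : (k %% n < n)%N by rewrite ltn_mod.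
  rewrite (divn_eq k n) (layout_out lay (Ordinal lt_q) (Ordinal lt_r)).
  by rewrite (adjacency_arrayE M (Ordinal lt_q) (Ordinal lt_r)).
by split=> //; apply: le_rat_bound.
Qed.
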